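(* Let $p\in(0,1]$ and let $(A,\|\cdot\|)$ be a complex $p$-Banach algebra with unit such that $\|a\|^2\le m\|a^2\|$ for some positive constant $m$ and all $a\in A$. Then the Gelfand map $G:A\to C(M(A))$ is an isomorphism of complex algebras onto its image (an injective algebra homomorphism) such that $$m^{-2/p}\|a\|^{1/p}\le m^{-1/p}|a|\le\|G(a)\|_s\le|a|\le\|a\|^{1/p}\quad\text{for all } a\in A,$$ where $|\cdot|$ is the support seminorm of $\|\cdot\|$ and $\|\cdot\|_s$ is the supremum norm on $C(M(A))$.
   Context: Algebras are associative and not assumed commutative. For $p\in(0,1]$, a $p$-homogeneous norm on a complex algebra $A$ is a map $\|\cdot\|:A\to[0,\infty)$ with $\|a+b\|\le\|a\|+\|b\|$, $\|\alpha a\|=|\alpha|^p\|a\|$ ($\alpha\in\mathbb{C}$), and $\|a\|=0$ only if $a=0$. A complex $p$-Banach algebra is a complex algebra with a complete submultiplicative ($\|ab\|\le\|a\|\|b\|$) $p$-homogeneous norm. The support seminorm of $\|\cdot\|$ is $|a|=\inf\sum_{i=1}^n\|a_i\|^{1/p}$, the infimum being taken over all finite decompositions $a=\sum_{i=1}^n a_i$ with $a_1,\dots,a_n\in A$. $M(A)$ is the set of all nonzero continuous multiplicative linear functionals $A\to\mathbb{C}$, with the Gelfand topology (the weakest topology making every $f\mapsto f(a)$, $a\in A$, continuous). $C(M(A))$ is the algebra of complex-valued continuous functions on $M(A)$, and the Gelfand map is $G(a)(f)=f(a)$. *)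

(* Defs.v *)
From HB Require Import structures.
From mathcomp Require Import all_boot all_order all_algebra.
From mathcomp Require Import complex.
From mathcomp Require Import all_classical all_reals all_analysis.

Set Implicit Arguments.
Unset Strict Implicit.
Unset Printing Implicit Defensive.

Import Order.TTheory GRing.Theory Num.Theory.
Import numFieldNormedType.Exports.

Local Open Scope classical_set_scope.
Local Open Scope ring_scope.
Local Open Scope complex_scope.

(* The norm of R[i] takes its values in R[i]; this one takes them in R. *)
Notation modulus := ComplexField.Normc.normc (only parsing).

(* [algType] is unital with 1 != 0.  The entourages of A are those of the metric
   [pnorm (a - b)], so continuity on A is the library's [continuous].  The
   library's [Complete] is not used because it also requires a pointed type, for
   which there is no join with algebras; [pnorm_complete] is its axiom.  The
   condition 0 < p <= 1 is not part of the structure. *)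
HB.mixin Record isPBanachAlgebra (R : realType) (p : R) A
    & GRing.Algebra R[i] A & Uniform A := {
  pnorm : A -> R ;
  pnorm_ge0 : forall a, 0 <= pnorm a ;
  pnormD : forall a b, pnorm (a + b) <= pnorm a + pnorm b ;
  pnormZ : forall (k : R[i]) a, pnorm (k *: a) = modulus k `^ p * pnorm a ;
  pnorm0_eq0 : forall a, pnorm a = 0 -> a = 0 ;
  pnormM : forall a b, pnorm (a * b) <= pnorm a * pnorm b ;
  entourage_pnormE :
    @entourage A = entourage_ (fun a e => [set b | pnorm (a - b) < e]) ;
  pnorm_complete : forall F : set_system A,
    ProperFilter F -> cauchy F -> exists l : A, F --> l
}.

#[short(type="pBanachAlgType")]
HB.structure Definition PBanachAlgebra (R : realType) (p : R) :=
  {A of GRing.Algebra R[i] A & Uniform A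
      & isPBanachAlgebra R p A}.

Definition support_seminorm (R : realType) (p : R) (A : pBanachAlgType p)
    (a : A) : R :=
  inf [set r | exists (n : nat) (s : 'I_n.+1 -> A),
         a = \sum_(i < n.+1) s i /\
         r = \sum_(i < n.+1) pnorm (s i) `^ p^-1].

(* C(X) inherits the pointwise operations of X -> R[i]^o, where R[i]^o is R[i]
   with the topology of its norm.  No unit is required to be nonzero since X may
   be empty. *)
Section continuous_algebra.
Context (R : realType) (X : topologicalType).
Notation C := (R[i]^o).
Notation T := (continuousType X C).

Definition cts_pred : {pred X -> C} := [pred f | `[< continuous f >]].

Section sub.
Context (f : X -> C) (fP : f \in cts_pred).
Definition cts_Sub : T := mkcts (asboolW fP).
End sub.

Lemma cts_rect (K : T -> Type) :
  (forall f (fP : f \in cts_pred), K (cts_Sub fP)) -> forall u : T, K u.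
Proof.
move=> Ksub u; have uP : (u : X -> C) \in cts_pred.
  by apply/asboolP; exact: cts_fun.
by have := Ksub _ uP; congr (K _); exact/continuousEP.
Qed.

Lemma cts_valP f (fP : f \in cts_pred) : cts_Sub fP = f :> (X -> C).
Proof. by []. Qed.

HB.instance Definition _ := isSub.Build _ _ T cts_rect cts_valP.

Lemma cts_subring_closed : subring_closed cts_pred.
Proof.
split=> [|f g /asboolP cf /asboolP cg|f g /asboolP cf /asboolP cg];
  apply/asboolP => x.
- exact: cvg_cst.
- exact: (cvgB (cf x) (cg x)).
- exact: (cvgM (cf x) (cg x)).
Qed.

HB.instance Definition _ :=
  GRing.isSubringClosed.Build _ cts_pred cts_subring_closed.
HB.instance Definition _ :=
  GRing.SubChoice_isSubPzRing.Build _ _ T (GRing.subringClosedP cts_pred).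

Lemma cts_scaler_closed : scaler_closed cts_pred.
Proof.
move=> k f /asboolP cf; apply/asboolP => x.
exact: (cvgM (cvg_cst (k : C)) (cf x)).
Qed.

HB.instance Definition _ :=
  GRing.isScaleClosed.Build _ _ cts_pred cts_scaler_closed.
HB.instance Definition _ := [SubZmodule_isSubLmodule of T by <:].

(* Extended-real valued, so that unbounded functions have norm +oo; the value is
   -oo when X is empty. *)
Definition sup_norm (g : T) : \bar R :=
  ereal_sup [set (modulus (g x))%:E | x in [set: X]].

End continuous_algebra.

Section gelfand.
Context (R : realType) (p : R) (A : pBanachAlgType p).
Notation C := (R[i]^o).

Definition is_character (f : A -> C) : Prop :=
  [/\ scalar f, (forall a b, f (a * b) = f a * f b), continuous f
    & exists a, f a != 0].

Definition gelfand_space : Type := set_type [set f | is_character f].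

HB.instance Definition _ := Choice.on gelfand_space.

Definition gelfand_eval (a : A) (f : gelfand_space) : C := val f a.

(* The weakest topology making all the evaluations continuous. *)
HB.instance Definition _ := Topological.copy gelfand_space
  (sup_topology (fun a => Topological.class
     (initial_topology (gelfand_eval a)))).

Lemma gelfand_eval_continuous (a : A) : continuous (gelfand_eval a).
Proof.
move=> f.
have [+ _] := @cvg_sup _ _ (fun a => Topological.class
  (initial_topology (gelfand_eval a))) (nbhs f) f (nbhs_filter f).
move=> /(_ (@cvg_id _ (nbhs f)) a) fa.
exact: cvg_comp fa (@initial_continuous _ _ (gelfand_eval a) f).
Qed.

Definition gelfand (a : A) : continuousType gelfand_space C :=
  mkcts (@gelfand_eval_continuous a).

End gelfand.

(* Main.v *)
Require Import Defs.
From HB Require Import structures.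
From mathcomp Require Import all_boot all_order all_algebra.
From mathcomp Require Import complex.
From mathcomp Require Import all_classical all_reals all_analysis.
From mathcomp Require Import ring lra zify.

Set Implicit Arguments.
Unset Strict Implicit.
Unset Printing Implicit Defensive.

Import Order.TTheory GRing.Theory Num.Theory.
Import numFieldNormedType.Exports.

Local Open Scope ring_scope.

(** Let [|.|] denote the p-norm.  The estimate [|a|^2 <= m |a^2|] makes it comparable
    with a quantity that only sees the growth of powers, the spectral radius
    [rho a = lim |a^n|^(1/(pn))]: iterating the estimate along [n = 2^j] gives
    [|a|^(1/p) <= m^(1/p) rho a].  The whole theorem follows once every [a] has a
    character [f] with [|f a| = rho a] (for [a = 0], any character will do):
    every character is bounded by [|.|^(1/p)], hence by the support seminorm, so
    that [|a|^(1/p) <= m^(1/p) |f a|] gives the lower estimates of both norms.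

    For [p < 1] there may be too few continuous linear functionals for duality
    arguments; the construction of characters rests on three elementary facts.

    Commutativity ([commutative_of_norm_sqr]).  Powers of [x y] and [y x] grow alike,
    so [|x y| <= m |y x|]; thus [exp (z a) b exp (- z a)], whose coefficients are
    [ad_a^k b / k!], is bounded in [z].  In a p-norm, Cauchy's estimate for a
    polynomial of degree [N] loses a factor [N^(1-p)]; with [(1 + z a)^h] in place of
    the exponential one takes [N ~ h ~ |z|^2], and the loss is compensated as soon
    as [k p >= 2], so that [ad_a^k = 0] for large [k].  If [c = ad_a b] commutes with
    [a], then [exp (z a) b exp (- z a) = b + z c] is bounded, so [c = 0]; this brings
    the order of nilpotency down to [1].

    Subadditivity ([spectral_radiusD]).  In a commutative algebra, the [p]-th powers
    of the binomial coefficients in the p-norm of [(a + b)^N] are those that occur in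
    [((rho a + rho b)^N)^p], so [rho] is a seminorm in the ordinary sense, which is
    submultiplicative and satisfies [rho (a^2) = rho a ^ 2].

    Gelfand-Mazur ([exists_multiplicative], [spectrum_nonempty]).  Zorn's lemma gives
    a minimal seminorm [q <= rho] with [q (a x) = rho a * q x]; minimality makes it
    multiplicative.  For a multiplicative seminorm, an argument of Ostrowski
    produces for each [x] a scalar [z] with [q (x - z) = 0], and [x |-> z] is the
    character. *)

(** * Real estimates *)

Section real_estimates.
Context (R : realType).
Implicit Types (u v x y c C h : R) (n j l : nat).

Lemma bernoulli h n : 0 <= h -> 1 + h *+ n <= (1 + h) ^+ n.
Proof.
move=> h0; elim: n => [|n IH]; first by rewrite expr0 mulr0n addr0.
rewrite exprS (le_trans _ (ler_wpM2l _ IH)) ?addr_ge0// mulrSr.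
have : 0 <= h * (h *+ n) by rewrite mulr_ge0// mulrn_wge0.
by nra.
Qed.

Lemma le_of_forall_mulrn x C : (forall n, x *+ n <= C) -> x <= 0.
Proof.
move=> H; rewrite leNgt; apply/negP => x0.
have /archi_boundP : 0 <= C / x.
  by rewrite divr_ge0 ?(ltW x0)//; have := H 0%N; rewrite mulr0n.
rewrite ltr_pdivrMr// mulr_natl; apply/negP; rewrite -leNgt; exact: H.
Qed.

Lemma le_of_forall_geometric b x C :
  1 < b -> (forall n, b ^+ n * x <= C) -> x <= 0.
Proof.
move=> b1 H; rewrite leNgt; apply/negP => x0.
suff : (b - 1) * x <= 0 by rewrite leNgt mulr_gt0// subr_gt0.
apply: (@le_of_forall_mulrn _ C) => n; apply: le_trans (H n).
rewrite -mulrnAl ler_wpM2r ?(ltW x0)//.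
have := @bernoulli (b - 1) n; rewrite subrKC subr_ge0 => /(_ (ltW b1)).
by apply: le_trans; rewrite lerDr.
Qed.

(** Polynomial factors are invisible to an n-th root: this is how multiplicative
    constants, and the number of terms of a binomial expansion, disappear. *)
Lemma le_of_forall_expr u v C : 0 <= v ->
    (forall j, u ^+ (2 ^ j) <= C * (2 ^ j).+1%:R * v ^+ (2 ^ j)) ->
  u <= v.
Proof.
move=> v0 H; rewrite leNgt; apply/negP => uv.
have u0 : 0 < u by exact: le_lt_trans uv.
have C0 : 0 <= C.
  rewrite leNgt; apply/negP => C0; have := H 0%N; apply/negP; rewrite -ltNge.
  rewrite expr1 (le_lt_trans _ u0)// mulr_le0_ge0 ?exprn_ge0//.
  by rewrite mulr_le0_ge0// ltW.
have [v_eq0|vneq0] := eqVneq v 0.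
  by have := H 0%N; rewrite v_eq0 !expr1 mulr0 leNgt u0.
have {}v0 : 0 < v by rewrite lt_def vneq0.
have [h uvE] : exists h, u / v = 1 + h by exists (u / v - 1); rewrite subrKC.
have h0 : 0 < h by rewrite -(ltrD2l 1) addr0 -uvE ltr_pdivlMr// mul1r.
have bnd j : (1 + h) ^+ (2 ^ j) <= C * (2 ^ j).+1%:R.
  by rewrite -uvE expr_div_n ler_pdivrMr ?exprn_gt0.
suff : h ^+ 2 <= 0 by rewrite leNgt exprn_gt0.
apply: (@le_of_forall_geometric 2 _ (3 * C)); first by rewrite ltr1n.
move=> j; have := bnd j.+1.
rewrite expnS mulnC exprM => /(le_trans _) le1.
have /le1 {le1} : (h *+ 2 ^ j) ^+ 2 <= ((1 + h) ^+ (2 ^ j)) ^+ 2.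
  rewrite lerXn2r ?nnegrE ?exprn_ge0 ?addr_ge0 ?mulrn_wge0 ?(ltW h0)//.
  by apply: le_trans (bernoulli _ (ltW h0)); rewrite lerDr.
rewrite -natrX -[h *+ _]mulr_natl exprMn.
have N1 : 1 <= (2 ^ j)%:R :> R by rewrite ler1n expn_gt0.
rewrite -natr1 natrM; set N := _%:R in N1 * => le1.
have N0 : 0 < N by lra.
rewrite -(ler_pM2l N0) mulrA -expr2 (le_trans le1)//.
nra.
Qed.

Lemma expr1D_le (h : R) n : 0 <= h -> h <= 1 -> (1 + h) ^+ n <= 1 + h * (2 ^+ n - 1).
Proof.
move=> h0 h1; elim: n => [|n IH]; first by rewrite !expr0 subrr mulr0 addr0.
have : 1 <= 2 ^+ n :> R by rewrite exprn_ege1// ler1n.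
rewrite exprS (exprS 2 n); move: (2 ^+ n) IH => X IH X1.
have : (1 + h) * (1 + h) ^+ n <= (1 + h) * (1 + h * (X - 1)).
  by rewrite ler_wpM2l// addr_ge0.
by move=> /le_trans; apply; have := mulr_ge0 h0 (_ : 0 <= X - 1); nra.
Qed.

Lemma sum_geometric_le (x : R) n : 0 <= x -> x <= 2^-1 ->
  \sum_(i < n) x ^+ i.+1 <= 2 * x.
Proof.
move=> x0 x2.
suff : \sum_(i < n) x ^+ i.+1 + 2 * x ^+ n.+1 <= 2 * x.
  have := exprn_ge0 n.+1 x0; lra.
elim: n => [|n IH]; first by rewrite big_ord0 add0r expr1.
rewrite big_ord_recr/=; have := exprn_ge0 n.+1 x0.
by move: IH; rewrite (exprS x n.+1); nra.
Qed.

Lemma bin_le_expn n k : ('C(n, k) <= n ^ k)%N.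
Proof.
rewrite (@leq_trans (n ^_ k))//; first by rewrite -bin_ffact leq_pmulr// fact_gt0.
by elim: k => [//|k IH]; rewrite ffactnSr expnSr leq_mul ?leq_subr.
Qed.

Lemma binomial_term_le (x y : R) n (i : 'I_n.+1) : 0 <= x -> 0 <= y ->
  'C(n, i)%:R * x ^+ (n - i) * y ^+ i <= (x + y) ^+ n.
Proof.
move=> x0 y0; rewrite exprDn (bigD1 i)//= mulr_natl mulrnAl lerDl.
by apply: sumr_ge0 => j _; rewrite mulrn_wge0// mulr_ge0 ?exprn_ge0.
Qed.

Lemma exprn_powR (x r : R) n : 0 <= x -> (x ^+ n) `^ r = (x `^ r) ^+ n.
Proof.
by move=> x0; rewrite -powR_mulrn// powRAC powR_mulrn// powR_ge0.
Qed.

Section infima.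
Local Open Scope classical_set_scope.
Implicit Types E F : set R.
(** The condition under which [inf] is a genuine infimum; limits of decreasing
    sequences and of chains of seminorms are both taken as such infima. *)
Definition nneg_set E := E !=set0 /\ forall x, E x -> 0 <= x.

Lemma nneg_inf_le E x : nneg_set E -> E x -> inf E <= x.
Proof.
by move=> [_ E0] Ex; apply: ge_inf => //; exists 0 => y /E0.
Qed.

Lemma nneg_inf_ge0 E : nneg_set E -> 0 <= inf E.
Proof. by move=> [En E0]; apply: lb_le_inf. Qed.

Lemma le_inf_mull E c k : nneg_set E -> 0 <= k ->
  (forall x, E x -> c <= k * x) -> c <= k * inf E.
Proof.
move=> [En E0] k0 H.
have [k_eq0|kneq0] := eqVneq k 0.
  by case: En => x /H; rewrite k_eq0 !mul0r.
have {}k0 : 0 < k by rewrite lt_def kneq0.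
rewrite mulrC -ler_pdivrMr//; apply: lb_le_inf => // x /H.
by rewrite ler_pdivrMr// mulrC.
Qed.

Lemma le_inf_mul E F c : nneg_set E -> nneg_set F ->
  (forall x y, E x -> F y -> c <= x * y) -> c <= inf E * inf F.
Proof.
move=> hE hF H; apply: le_inf_mull => //; first exact: nneg_inf_ge0.
move=> y Fy; rewrite mulrC; apply: le_inf_mull => //; first by case: hF => _; exact.
by move=> x Ex; rewrite mulrC; exact: H.
Qed.

Lemma le_inf_add E F c : nneg_set E -> nneg_set F ->
  (forall x y, E x -> F y -> c <= x + y) -> c <= inf E + inf F.
Proof.
move=> [En _] [Fn _] H; rewrite -lerBlDr; apply: lb_le_inf => // x Ex.
rewrite lerBlDr -lerBlDl; apply: lb_le_inf => // y Fy.
by rewrite lerBlDl; exact: H.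
Qed.

End infima.

Section powers.
Context (p : R) (p_gt0 : 0 < p).

Lemma dyadic_powR (s : R) l : 0 <= s ->
  (s / 2 ^+ l) `^ p = s `^ p / (2 `^ p) ^+ l.
Proof.
move=> s0; rewrite powRM ?invr_ge0 ?exprn_ge0//; congr (_ * _).
by rewrite -exprn_powR// -powR_inv1 ?exprn_ge0// powRAC powR_inv1 ?powR_ge0.
Qed.

Lemma four_powR l : (4 ^ l)%:R `^ p = ((2 `^ p) ^+ l) ^+ 2 :> R.
Proof.
by rewrite -!exprn_powR ?exprn_ge0// -!natrX -expnM mulnC expnM.
Qed.

Lemma two_powR_gt1 : 1 < 2 `^ p :> R.
Proof.
rewrite -[ltLHS](powRr0 2) lt_neqAle ler_powR ?ler1n ?(ltW p_gt0)// andbT.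
by rewrite powRr0 eq_sym powR_eq1 !negb_or -leNgt ler0n (gt_eqF p_gt0) pnatr_eq1.
Qed.

(** Chooses the radius [s] below which a perturbation of size [K * s ^ p] is
    harmless. *)
Lemma small_root (K : R) : 0 <= K -> exists s : R,
  [/\ 0 < s, s `^ p * K <= 4^-1 & s `^ p <= 1].
Proof.
move=> K0; set c : R := (4 * (K + 1))^-1.
have c0 : 0 < c by rewrite invr_gt0 mulr_gt0// ltr_wpDl.
exists (c `^ p^-1); rewrite powR_gt0// -powRrM mulVf ?gt_eqF// powRr1 ?(ltW c0)//.
split=> //.
  by rewrite /c invfM -mulrA ler_piMr// mulrC ler_pdivrMr ?ltr_wpDl// mul1r lerDl.
by rewrite invf_le1 ?mulr_gt0 ?ltr_wpDl//; lra.
Qed.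

End powers.

End real_estimates.

(** * The modulus *)

Section modulus_theory.
Context (R : realType).
Implicit Types (x y : R[i]).

Lemma modulus_norm x : `|x| = (modulus x)%:C%C.
Proof. by case: x. Qed.

Lemma modulus_ge0 x : 0 <= modulus x.
Proof. by case: x => a b; exact: sqrtr_ge0. Qed.

Lemma modulus0 : modulus (0 : R[i]) = 0.
Proof. exact: ComplexField.Normc.normc0. Qed.

Lemma modulus1 : modulus (1 : R[i]) = 1.
Proof. exact: ComplexField.Normc.normc1. Qed.

Lemma modulusM x y : modulus (x * y) = modulus x * modulus y.
Proof. exact: ComplexField.Normc.normcM. Qed.

Lemma modulusX x n : modulus (x ^+ n) = modulus x ^+ n.
Proof.
by elim: n => [|n IH]; rewrite ?expr0 ?modulus1// !exprS modulusM IH.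
Qed.

Lemma modulusN x : modulus (- x) = modulus x.
Proof. exact: (@normcN R). Qed.

Lemma modulus_real (r : R) : 0 <= r -> modulus r%:C%C = r.
Proof. by move=> r0; rewrite /= expr0n addr0 sqrtr_sqr ger0_norm. Qed.

Lemma modulus_nat n : modulus (n%:R : R[i]) = n%:R.
Proof.
have -> : (n%:R : R[i]) = (n%:R : R)%:C%C by rewrite rmorph_nat.
exact: modulus_real.
Qed.

Lemma modulus_gt0 x : x != 0 -> 0 < modulus x.
Proof.
move=> x0; rewrite lt_def modulus_ge0 andbT.
by apply: contra x0 => /eqP/ComplexField.Normc.eq0_normc ->.
Qed.

Lemma modulusV x : modulus x^-1 = (modulus x)^-1.
Proof. exact: ComplexField.Normc.normcV. Qed.

Lemma modulusD x y : modulus (x + y) <= modulus x + modulus y.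
Proof. exact: (@le_normcD R). Qed.

End modulus_theory.

(** * Formal conjugation by an exponential *)

Section formal_conjugation.
Context (A : nzRingType).
Implicit Types (a b : A) (q : {poly A}).

Definition commutator a b := a * b - b * a.

Lemma exprM_swap (x y : A) n : (x * y) ^+ n.+1 = x * (y * x) ^+ n * y.
Proof.
elim: n => [|n IH]; first by rewrite expr1 expr0 mulr1.
by rewrite exprS IH [in RHS]exprS !mulrA.
Qed.

Lemma mul1BD (x : A) n : (1 - x) ^+ n * (1 + x) ^+ n = (1 - x ^+ 2) ^+ n.
Proof.
have cx : GRing.comm (1 - x) (1 + x).
  by rewrite /GRing.comm mulrBl mulrBr mul1r mulr1 mulrDr mulrDl mul1r mulr1.
by rewrite -exprMn_comm// mulrBl mul1r mulrDr mulr1 expr2 opprD addrA addrK.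
Qed.

(** A polynomial version of [exp x b exp (- x) = b + (x b - b x)], valid when
    [x b - b x] commutes with [x]; the powers of [1 - x ^ 2] are close to [1]. *)
Lemma conj_commutator (x b : A) n : commutator x (commutator x b) = 0 ->
  (1 + x) ^+ n.+1 * b * (1 - x) ^+ n.+1 =
  b * (1 - x ^+ 2) ^+ n.+1 + commutator x b * ((1 - x ^+ 2) ^+ n * (1 - x)) *+ n.+1.
Proof.
have [c cE] : exists c, commutator x b = c by eexists.
rewrite cE => xc.
have cx : GRing.comm c (1 + x).
  rewrite /GRing.comm mulrDr mulrDl mulr1 mul1r; congr (_ + _).
  by apply/esym/eqP; rewrite -subr_eq0; apply/eqP.
have c1 : (1 + x) * b = b * (1 + x) + c.
  by rewrite mulrDl mulrDr mul1r mulr1 -cE /commutator -addrA [_ * x + _]addrC subrK.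
have H k : (1 + x) ^+ k.+1 * b = b * (1 + x) ^+ k.+1 + c * (1 + x) ^+ k *+ k.+1.
  elim: k => [|k IH]; first by rewrite !expr1 expr0 mulr1 c1.
  rewrite exprS -mulrA IH mulrDr mulrA c1 mulrDl -mulrA -exprS -addrA; congr (_ + _).
  by rewrite mulrnAr mulrA -cx -mulrA -exprS -mulrS.
have swap k : (1 + x) ^+ k * (1 - x) ^+ k = (1 - x ^+ 2) ^+ k.
  rewrite -mul1BD; apply: commrX; apply/commr_sym/commrX/commr_sym.
  by rewrite /GRing.comm mulrBr mulrBl mulr1 mul1r mulrDl mulrDr mul1r mulr1.
rewrite H mulrDl; congr (_ + _); first by rewrite -mulrA swap.
by rewrite mulrnAl -mulrA; congr (c * _ *+ _); rewrite [X in _ * X]exprSr mulrA swap.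
Qed.

Definition conj_step a q := (1 + a%:P * 'X) * q * (1 - a%:P * 'X).

(** Stands for [exp (h a X) q exp (- h a X)], with factors [1 + a X] and [1 - a X]
    that are inverse to each other up to [X ^ 2]. *)
Definition conj_poly a h q :=
  (1 + a%:P * 'X) ^+ h * q * (1 - a%:P * 'X) ^+ h.

Lemma conj_polyS a h q : conj_poly a h.+1 q = conj_poly a h (conj_step a q).
Proof. by rewrite /conj_poly exprSr exprS !mulrA. Qed.

Lemma coef_conj_step a q i : (conj_step a q - q)`_i =
  if i is j.+1 then commutator a q`_j - (if j is l.+1 then a * q`_l * a else 0)
  else 0.
Proof.
have -> : conj_step a q - q = a%:P * ('X * q) - q * a%:P * 'X
    - a%:P * ('X * q) * a%:P * 'X.
  rewrite /conj_step mulrBr mulrDl mul1r mulr1 mulrDl !mulrA opprD.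
  by rewrite [LHS]addrAC [q + _]addrC addrK addrA.
rewrite !(coefB, coefMX, coefCM, coefXM, coefMC).
by case: i => [|[|i]]; rewrite ?mulr0 ?mul0r ?subr0.
Qed.

(** Conjugation is [1 + h X ad_a] up to terms of higher valuation. *)
Lemma coef_conj_poly a h q k : (forall i, (i < k)%N -> q`_i = 0) ->
  (forall i, (i <= k)%N -> (conj_poly a h q - q)`_i = 0) /\
  (conj_poly a h q - q)`_k.+1 = commutator a q`_k *+ h.
Proof.
elim: h q => [|h IH] q q0.
  by rewrite /conj_poly !expr0 mul1r mulr1 subrr mulr0n; split=> [i _|]; rewrite coef0.
have step0 i : (i <= k)%N -> (conj_step a q - q)`_i = 0.
  rewrite coef_conj_step; case: i => [//|i] ik; rewrite q0// /commutator mulr0 mul0r.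
  by case: i ik => [|i] ik; rewrite ?subrr// q0 1?ltnW// mulr0 mul0r !subr0.
have stepk : (conj_step a q - q)`_k.+1 = commutator a q`_k.
  by rewrite coef_conj_step; case: k q0 {step0 IH} => [|k] q0; rewrite ?(q0 k)// ?mulr0 ?mul0r subr0.
have stepE i : (i <= k)%N -> (conj_step a q)`_i = q`_i.
  by move=> /step0/eqP; rewrite coefB subr_eq0 => /eqP.
have [|IH1 IH2] := IH (conj_step a q).
  by move=> i ik; rewrite stepE ?q0// ltnW.
have E : conj_poly a h.+1 q - q =
    conj_poly a h (conj_step a q) - conj_step a q + (conj_step a q - q).
  by rewrite conj_polyS addrA subrK.
split=> [i ik|]; first by rewrite E coefD IH1// step0// addr0.
by rewrite E coefD IH2 stepk stepE// mulrSr.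
Qed.

Definition conj_diff a h q := conj_poly a h q - q.

(** [conj_diff a h] stands for [exp (h X ad_a) - 1]: its [k]-th iterate has no terms
    below [h ^ k ad_a^k X ^ k], and no factorial appears in this coefficient. *)
Lemma coef_conj_diff a h k b :
  (forall i, (i < k)%N -> (iter k (conj_diff a h) b%:P)`_i = 0) /\
  (iter k (conj_diff a h) b%:P)`_k = iter k (commutator a) b *+ h ^ k.
Proof.
elim: k => [|k [IH1 IH2]]; first by split=> //=; rewrite coefC.
have [H1 H2] := coef_conj_poly a h IH1; split; first by move=> i; exact: H1.
rewrite iterS H2 IH2 expnSr mulrnA /= /commutator.
by rewrite mulrnAr mulrnAl -mulrnBl.
Qed.

Lemma size_conj_diff a h k b :
  (size (iter k (conj_diff a h) b%:P) <= (2 * h * k).+1)%N.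
Proof.
have lin (c : A) : (size (1 + c%:P * 'X)%R <= 2)%N.
  rewrite (leq_trans (size_polyD _ _))// geq_max size_poly1/=.
  by rewrite (leq_trans (size_polyMleq _ _))// size_polyX size_polyC; case: eqP.
have pow (c : A) : (size ((1 + c%:P * 'X) ^+ h)%R <= h.+1)%N.
  by rewrite (leq_trans (size_poly_exp_leq _ _))// ltnS -[leqRHS]mul1n leq_mul2r -ltnS ltnS; have := lin c; lia.
elim: k => [|k IH]; first by rewrite muln0 size_polyC; case: eqP.
rewrite iterS; set q := iter k _ _ in IH *.
rewrite (leq_trans (size_polyD _ _))// geq_max size_polyN; apply/andP; split; last first.
  by move: IH; lia.
have sM (r s : {poly A}) x y : (size r <= x.+1)%N -> (size s <= y.+1)%N ->
    (size (r * s)%R <= (x + y).+1)%N.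
  by move=> rx sy; rewrite (leq_trans (size_polyMleq _ _))//; lia.
rewrite (@leq_trans (h + 2 * h * k + h).+1)//; last by lia.
apply: (sM); first exact: sM.
by rewrite -mulNr -polyCN; exact: pow.
Qed.

End formal_conjugation.

(** * Norms of products and powers *)

Section pnorm_theory.
Context (R : realType) (p : R) (p_gt0 : 0 < p).
Context (A : pBanachAlgType p).
Implicit Types (a b x y : A) (n : nat).

Lemma pnorm0 : pnorm (0 : A) = 0.
Proof. by rewrite -(scale0r (0 : A)) pnormZ modulus0 powR0 ?mul0r ?gt_eqF. Qed.

Lemma pnormN a : pnorm (- a) = pnorm a.
Proof. by rewrite -scaleN1r pnormZ modulusN modulus1 powR1 mul1r. Qed.

Lemma pnormB a b : pnorm (a - b) <= pnorm a + pnorm b.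
Proof. by rewrite (le_trans (pnormD _ _))// pnormN. Qed.

Lemma pnorm_sum I (r : seq I) (P : pred I) (F : I -> A) :
  pnorm (\sum_(i <- r | P i) F i) <= \sum_(i <- r | P i) pnorm (F i).
Proof.
elim/big_ind2 : _ => [|x u y v xu yv|//]; first by rewrite pnorm0.
exact: le_trans (pnormD _ _) (lerD xu yv).
Qed.

Lemma pnormMn a n : pnorm (a *+ n) = n%:R `^ p * pnorm a.
Proof. by rewrite -scaler_nat pnormZ modulus_nat. Qed.

Lemma pnormXS a n : pnorm (a ^+ n.+1) <= pnorm a ^+ n.+1.
Proof.
elim: n => [|n IH]; first by rewrite !expr1.
rewrite exprS [leRHS]exprS (le_trans (pnormM _ _))//.
by rewrite ler_wpM2l// pnorm_ge0.
Qed.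

Lemma pnorm_gt0 a : a != 0 -> 0 < pnorm a.
Proof.
move=> a0; rewrite lt_def pnorm_ge0 andbT.
by apply: contra a0 => /eqP/pnorm0_eq0 ->.
Qed.

Lemma pnorm1_ge1 : 1 <= pnorm (1 : A).
Proof.
have n0 := pnorm_gt0 (oner_neq0 A).
by rewrite -(ler_pM2l n0) mulr1 (le_trans _ (pnormM _ _))// mulr1.
Qed.

Lemma pnormX a n : pnorm (a ^+ n) <= pnorm (1 : A) * pnorm a ^+ n.
Proof.
case: n => [|n]; first by rewrite !expr0 mulr1.
rewrite (le_trans (pnormXS _ _))// ler_peMl ?exprn_ge0 ?pnorm_ge0//.
exact: pnorm1_ge1.
Qed.

Context (m : R) (m_gt0 : 0 < m)
  (norm_sqr : forall a : A, pnorm a ^+ 2 <= m * pnorm (a ^+ 2)).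

(** Iterates the hypothesis on the squares; the factor [m] on the left makes the
    exponents of [m] add up. *)
Lemma pnorm_expr2 a j : m * pnorm a ^+ (2 ^ j) <= m ^+ (2 ^ j) * pnorm (a ^+ (2 ^ j)).
Proof.
elim: j => [|j IH]; first by rewrite !expr1.
rewrite -(ler_pM2l m_gt0) expnSr !exprM mulrA -expr2 -exprMn.
apply: (@le_trans _ _ ((m ^+ (2 ^ j) * pnorm (a ^+ (2 ^ j))) ^+ 2)).
  by rewrite lerXn2r ?nnegrE ?mulr_ge0 ?exprn_ge0 ?pnorm_ge0 ?(ltW m_gt0).
rewrite exprMn [leRHS]mulrCA ler_wpM2l ?exprn_ge0 ?(ltW m_gt0)//.
Qed.

(** [x * y] and [y * x] have the same powers up to the two outer factors, hence
    the same growth, and the norm is governed by the growth of powers. *)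
Lemma pnorm_mulC x y : pnorm (x * y) <= m * pnorm (y * x).
Proof.
have [yx0|yx0] := eqVneq (y * x) 0.
  have : pnorm (x * y) ^+ 2 <= m * 0.
    by rewrite (le_trans (norm_sqr _))// exprM_swap yx0 expr1 mulr0 mul0r pnorm0.
  rewrite mulr0 yx0 pnorm0 mulr0 => H.
  by rewrite -(@ler_pXn2r _ 2) ?nnegrE ?pnorm_ge0// expr0n.
have w0 := pnorm_gt0 yx0.
set C := pnorm x * pnorm (1 : A) * pnorm y / (m * pnorm (y * x)).
apply: (@le_of_forall_expr _ _ _ C); first by rewrite mulr_ge0 ?(ltW w0) ?(ltW m_gt0).
move=> j; have := pnorm_expr2 (x * y) j.
have C0 : 0 <= C by rewrite !mulr_ge0 ?invr_ge0 ?mulr_ge0 ?pnorm_ge0 ?(ltW m_gt0).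
case: (2 ^ j)%N (expn_gt0 2 j) => [//|n _] le1.
have {}le1 : m * pnorm (x * y) ^+ n.+1 <= m * (C * (m * pnorm (y * x)) ^+ n.+1).
  apply: le_trans le1 _.
  have -> : m * (C * (m * pnorm (y * x)) ^+ n.+1)
      = m ^+ n.+1 * (m * C * pnorm (y * x) ^+ n.+1) by rewrite exprMn; ring.
  rewrite ler_wpM2l ?exprn_ge0 ?(ltW m_gt0)//.
  rewrite exprM_swap (le_trans (pnormM _ _))//.
  rewrite [leRHS](_ : _ = pnorm x * (pnorm (1 : A) * pnorm (y * x) ^+ n) * pnorm y).
    rewrite ler_wpM2r ?pnorm_ge0// (le_trans (pnormM _ _))//.
    by rewrite ler_wpM2l ?pnorm_ge0 ?pnormX.
  by rewrite /C exprS; field; rewrite !gt_eqF.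
move: le1; rewrite ler_pM2l// => /le_trans; apply.
rewrite ler_wpM2r ?exprn_ge0 ?mulr_ge0 ?(ltW w0) ?(ltW m_gt0)//.
by rewrite ler_peMr// ler1n.
Qed.

End pnorm_theory.

(** * Cauchy's estimate in a p-norm *)

Section polynomials_on_scalars.
Context (C : comNzRingType) (A : algType C).
Implicit Types (q r : {poly A}) (z : C) (a : A).

Lemma horner_algM q r z : (q * r).[z%:A] = q.[z%:A] * r.[z%:A].
Proof.
rewrite hornerM_comm// /comm_poly horner_coef mulr_suml mulr_sumr.
by apply: eq_bigr => i _; rewrite mulr_algr mulr_algl.
Qed.

Lemma horner_algX q z n : (q ^+ n).[z%:A] = q.[z%:A] ^+ n.
Proof.
by elim: n => [|n IH]; rewrite ?expr0 ?hornerC// !exprS horner_algM IH.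
Qed.

Lemma alg_exp z n : (z%:A : A) ^+ n = (z ^+ n)%:A.
Proof. by rewrite exprZn expr1n. Qed.

Lemma horner_even_odd q z :
  q.[z%:A] = (even_poly q).[(z ^+ 2)%:A] + z *: (odd_poly q).[(z ^+ 2)%:A].
Proof.
rewrite -{1}(poly_even_odd q) hornerD hornerMX mulr_algr.
have E r : (r \Po 'X^2).[z%:A] = r.[(z ^+ 2)%:A].
  rewrite comp_polyE horner_sum horner_coef; apply: eq_bigr => i _.
  by rewrite hornerZ horner_algX hornerXn alg_exp.
by rewrite !E.
Qed.

End polynomials_on_scalars.

Section coefficient_estimate.
Context (R : realType) (p : R) (p_gt0 : 0 < p).
Context (A : pBanachAlgType p).
Implicit Types (q : {poly A}).

(** Cauchy's estimate for the coefficients.  Averaging over the [2 ^ s]-th roots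
    of unity is replaced by [s] successive splittings into even and odd parts;
    each one costs a factor [2 ^ (1 - p)], which disappears only for [p = 1]. *)
Lemma cauchy_estimate s q (t M : R) : 0 < t -> (size q <= 2 ^ s)%N ->
    (forall z : R[i], modulus z = t -> pnorm q.[z%:A] <= M) ->
  forall i, pnorm q`_i * (t `^ p) ^+ i <= (2 / 2 `^ p) ^+ s * M.
Proof.
elim: s q t M => [|s IH] q t M t0 sq H i.
  rewrite expr0 mul1r; have := H t%:C%C; rewrite modulus_real ?(ltW t0)//.
  rewrite (size1_polyC sq) hornerC coefC => /(_ erefl).
  case: i => [|i]; first by rewrite expr0 mulr1.
  by rewrite pnorm0// mul0r; apply: le_trans; exact: pnorm_ge0.
have half (z w : R[i]) : modulus z = t -> w = z ^+ 2 ->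
    pnorm (even_poly q).[w%:A] <= 2 / 2 `^ p * M /\
    t `^ p * pnorm (odd_poly q).[w%:A] <= 2 / 2 `^ p * M.
  move=> zt ->{w}; have := H _ zt.
  have /H : modulus (- z) = t by rewrite modulusN.
  rewrite (horner_even_odd q z) (horner_even_odd q (- z)) sqrrN; set e := (even_poly q).[_]; set o := (odd_poly q).[_].
  have b2 : 0 < 2 `^ p :> R by rewrite powR_gt0.
  move=> le1 le2; split; rewrite mulrAC ler_pdivlMr//.
    rewrite mulrC -[X in X `^ p * _](@modulus_nat R) -pnormZ.
    rewrite (_ : _ *: _ = (e + (- z) *: o) + (e + z *: o)).
      by rewrite (le_trans (pnormD _ _))// mulr2n mulrDl mul1r lerD.
    by rewrite addrACA -scalerDl addNr scale0r addr0 scaler_nat.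
  have -> : t `^ p * pnorm o * 2 `^ p = pnorm ((2%:R : R[i]) *: (z *: o)).
    by rewrite !pnormZ zt modulus_nat mulrC.
  rewrite (_ : _ *: _ = (e + z *: o) - (e + (- z) *: o)).
    by rewrite (le_trans (pnormB _ _))// mulr2n mulrDl mul1r lerD.
  by rewrite opprD addrACA subrr add0r scaleNr opprK scaler_nat mulr2n.
have root_of (w : R[i]) : modulus w = t ^+ 2 -> exists z : R[i], modulus z = t /\ w = z ^+ 2.
  move=> wt; exists (sqrtC w); rewrite sqrtCK; split=> //.
  by apply/eqP; rewrite -(@eqrXn2 _ 2) ?modulus_ge0 ?(ltW t0)// -modulusX sqrtCK wt.
have tp0 : 0 < t `^ p by rewrite powR_gt0.
have t2E : (t ^+ 2) `^ p = (t `^ p) ^+ 2 by rewrite !expr2 powRM// ltW.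
have /IH IHe : 0 < t ^+ 2 by rewrite exprn_gt0.
have sE : (uphalf (size q) <= 2 ^ s)%N by move: sq; rewrite expnS; lia.
have sO : ((size q)./2 <= 2 ^ s)%N by move: sq; rewrite expnS; lia.
rewrite -(odd_double_half i); case: (odd i) => /=.
  have := IHe (odd_poly q) (2 / 2 `^ p * M / t `^ p) (leq_trans (size_odd_poly _) sO).
  rewrite t2E => /(_ _ i./2); rewrite -exprM mul2n coef_odd_poly => le1.
  have {le1} := le1 _; rewrite [_ ^+ s * _]mulrA ler_pdivlMr// => le1.
  rewrite add1n !exprSr mulrA -[leRHS]mulrA; apply: le1.
  move=> w /root_of[z [zt wz]]; rewrite ler_pdivlMr// mulrC.
  by have [] := half _ _ zt wz.
have := IHe (even_poly q) (2 / 2 `^ p * M) (leq_trans (size_even_poly _) sE).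
rewrite t2E => /(_ _ i./2); rewrite -exprM mul2n coef_even_poly => le1.
rewrite add0n [(2 / _) ^+ _]exprSr -[leRHS]mulrA; apply: le1.
by move=> w /root_of[z [zt wz]]; have [] := half _ _ zt wz.
Qed.

End coefficient_estimate.

(** * Commutativity *)

Section commutativity.
Context (R : realType) (p : R) (p_gt0 : 0 < p).
Context (A : pBanachAlgType p).
Context (m : R) (m_gt0 : 0 < m)
  (norm_sqr : forall a : A, pnorm a ^+ 2 <= m * pnorm (a ^+ 2)).
Implicit Types (a b x y : A) (q : {poly A}).

(** The p-norm takes the [p]-th power of the binomial coefficients, so that it is
    [n ^ p |x|] which has to be small.  The bound [n |x|] given by a telescoping sum
    would be useless for [p < 1]: below, [|x|] is of the order of [n ^ (- p)]. *)
Lemma pnorm_expr1B x n : n%:R `^ p * pnorm x <= 2^-1 ->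
  pnorm ((1 - x) ^+ n - 1) <= 2 * (n%:R `^ p * pnorm x).
Proof.
move=> x2; rewrite exprDn_comm; last by rewrite /GRing.comm mul1r mulr1.
rewrite big_ord_recl subn0 expr0 mulr1 expr1n bin0 mulr1n addrC addKr.
rewrite (le_trans (pnorm_sum p_gt0 _ _ _))//.
have z0 : 0 <= n%:R `^ p * pnorm x by rewrite mulr_ge0 ?powR_ge0 ?pnorm_ge0.
apply: le_trans (sum_geometric_le n z0 x2); apply: ler_sum => i _.
rewrite expr1n mul1r lift0 pnormMn exprMn.
rewrite ler_pM ?powR_ge0 ?pnorm_ge0//; last first.
  by rewrite (le_trans (pnormXS _ _))// pnormN.
rewrite -powR_mulrn ?powR_ge0// -powRrM [p * _]mulrC powRrM powR_mulrn ?ler0n//.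
rewrite ge0_ler_powR ?nnegrE ?(ltW p_gt0) ?ler0n ?exprn_ge0//.
by rewrite -natrX ler_nat bin_le_expn.
Qed.

(** Bounds [(1 - x) ^ n] as long as [n ^ p |x| <= 1 / 2]. *)
Definition exp_bound : R := pnorm (1 : A) + 1.

Lemma pnorm_expr1B_le x n : n%:R `^ p * pnorm x <= 2^-1 ->
  pnorm ((1 - x) ^+ n) <= exp_bound.
Proof.
move=> x2; rewrite -[_ ^+ n](subrK 1) (le_trans (pnormD _ _))// addrC lerD2l.
by rewrite (le_trans (pnorm_expr1B x2))// mulrC -ler_pdivlMr// mul1r.
Qed.

(** Moving the right factor to the left costs only [m], and there it nearly cancels
    the left factor: [(1 - x) ^ n (1 + x) ^ n = (1 - x ^ 2) ^ n]. *)
Lemma pnorm_conj_le x b n : n%:R `^ p * pnorm (x ^+ 2) <= 2^-1 ->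
  pnorm ((1 + x) ^+ n * b * (1 - x) ^+ n) <= m * (pnorm b * exp_bound).
Proof.
move=> x2; rewrite -mulrA (le_trans (pnorm_mulC _ m_gt0 norm_sqr _ _))// ler_pM2l//.
rewrite -mulrA mul1BD (le_trans (pnormM _ _))// ler_wpM2l ?pnorm_ge0//.
exact: pnorm_expr1B_le.
Qed.

Lemma horner_conj_poly a h q (z : R[i]) : (conj_poly a h q).[z%:A] =
  (1 + z *: a) ^+ h * q.[z%:A] * (1 - z *: a) ^+ h.
Proof.
rewrite /conj_poly !horner_algM !horner_algX; congr (_ ^+ _ * _ * _ ^+ _).
  by rewrite hornerD hornerM_comm ?hornerC ?hornerX ?mulr_algr//; exact: comm_polyX.
by rewrite hornerD hornerN hornerM_comm ?hornerC ?hornerX ?mulr_algr//; exact: comm_polyX.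
Qed.

(** An iterate of [conj_diff] is an alternating sum of conjugates.  The extra
    conjugation by the power [j] carries the induction: each difference doubles the
    bound and uses up [h] of the [K h] available powers. *)
Lemma pnorm_conj_diff_le a b h k K (z : R[i]) : (k <= K)%N ->
    (K * h)%:R `^ p * pnorm ((z *: a) ^+ 2) <= 2^-1 ->
  forall j, (j <= (K - k) * h)%N ->
  pnorm ((1 + z *: a) ^+ j * (iter k (conj_diff a h) b%:P).[z%:A] * (1 - z *: a) ^+ j)
    <= 2 ^+ k * (m * (pnorm b * exp_bound)).
Proof.
move=> + za; elim: k => [|k IH] kK j.
  rewrite subn0 => jK; rewrite hornerC mul1r; apply: pnorm_conj_le.
  apply: le_trans za; rewrite ler_wpM2r ?pnorm_ge0//.
  by rewrite ge0_ler_powR ?nnegrE ?ler0n ?(ltW p_gt0)// ler_nat.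
move=> jK; rewrite iterS {1}/conj_diff hornerD hornerN horner_conj_poly.
set q := iter k _ _ in IH *.
rewrite mulrBr mulrBl (le_trans (pnormB _ _))//.
rewrite [leRHS](_ : _ = 2 ^+ k * (m * (pnorm b * exp_bound)) *+ 2); last first.
  by rewrite exprS -mulrA mulr_natl.
rewrite mulr2n; move: (2 ^+ k * _) IH => B IH; rewrite lerD//.
  rewrite !mulrA -exprD -[_ * _ ^+ j]mulrA -exprD (addnC h); apply: IH; first exact: ltnW.
  by rewrite -(subSS k) subSn// mulSn addnC leq_add2l.
apply: IH; first exact: ltnW.
by rewrite (leq_trans jK)// leq_mul2r leq_sub2l ?orbT.
Qed.

(** The polynomial [q] with leading behaviour [h ^ k ad_a^k b X ^ k] is bounded on
    the circle of radius [t], with [h t ^ 2] constant, independently of [h].  As its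
    degree is of order [h], Cauchy's estimate gives
    [(h t) ^ (p k) |ad_a^k b| <= C h ^ (1 - p)], where [h t] is of order
    [h ^ (1 / 2)]; let [h = 4 ^ l] tend to infinity. *)
Lemma commutator_nilpotent a b k : 2 <= p *+ k -> iter k (commutator a) b = 0.
Proof.
move=> pk.
have k0 : (0 < k)%N by case: k pk => // ; rewrite mulr0n; lra.
have [|s [s0 sK s1]] := @small_root _ _ p_gt0 (k%:R `^ p * pnorm (a ^+ 2)).
  by rewrite mulr_ge0 ?powR_ge0 ?pnorm_ge0.
set D := iter k (commutator a) b; set beta := 2 `^ p : R.
set sig := s `^ p in sK s1.
have sig0 : 0 < sig by rewrite powR_gt0.
have beta1 : 1 < beta := two_powR_gt1 p_gt0.
have beta0 : 0 < beta by lra.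
set M := 2 ^+ k * (m * (pnorm b * exp_bound)).
have H l : (beta ^+ l) ^+ k * (sig ^+ k * pnorm D) <= (2 / beta) ^+ (2 * l + 2 * k).+1 * M.
  have tE : (s / 2 ^+ l) `^ p = sig / beta ^+ l by rewrite dyadic_powR// ltW.
  have t0 : 0 < s / 2 ^+ l by rewrite divr_gt0 ?exprn_gt0.
  set q := iter k (conj_diff a (4 ^ l)) b%:P.
  have qk : q`_k = D *+ (4 ^ l) ^ k by have [] := coef_conj_diff a (4 ^ l) k b.
  have szq : (size q <= 2 ^ (2 * l + 2 * k).+1)%N.
    rewrite (leq_trans (size_conj_diff _ _ _ _))// -addnS expnD expnM.
    have := ltn_expl (2 * k).+1 (isT : (1 < 2)%N); have : (0 < 4 ^ l)%N by rewrite expn_gt0.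
    rewrite -[(2 ^ 2)%N]/4%N; nia.
  have := cauchy_estimate p_gt0 t0 szq (M := M).
  move=> /(_ _ k); rewrite qk tE pnormMn.
  rewrite natrX exprn_powR// four_powR => le1.
  apply: le_trans (le1 _).
    rewrite expr_div_n -!exprM -/beta.
    have b0 : beta ^+ (l * k) != 0 by rewrite gt_eqF ?exprn_gt0.
    rewrite (_ : (l * (2 * k) = l * k + l * k)%N); last by lia.
    rewrite le_eqVlt; apply/orP; left; apply/eqP; rewrite exprD; field.
    by rewrite gt_eqF ?exprn_gt0.
  move=> z zt.
  have := @pnorm_conj_diff_le a b (4 ^ l) k k z (leqnn _).
  rewrite subnn mul0n => /(_ _ 0 isT); rewrite !expr0 mul1r mulr1; apply.
  rewrite exprZn pnormZ modulusX zt exprn_powR ?(ltW t0)// tE natrM powRM// four_powR -/beta.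
  have b0 : beta ^+ l != 0 by rewrite gt_eqF ?exprn_gt0.
  rewrite (_ : _ * _ = sig * (sig * (k%:R `^ p * pnorm (a ^+ 2)))); last by field.
  have : sig * (sig * (k%:R `^ p * pnorm (a ^+ 2))) <= 1 * 4^-1.
    by rewrite ler_pM ?mulr_ge0 ?powR_ge0 ?pnorm_ge0 ?(ltW sig0).
  lra.
apply: pnorm0_eq0; apply/eqP; rewrite eq_le pnorm_ge0 andbT.
suff : sig ^+ k * pnorm D <= 0 by rewrite pmulr_rle0// exprn_gt0.
apply: (@le_of_forall_geometric _ (beta ^+ 2) _ ((2 / beta) ^+ (2 * k).+1 * M)).
  by rewrite exprn_egt1.
move=> l; have := H l; rewrite -addnS exprD expr_div_n [in X in _ <= X -> _]exprM.
(* [beta ^ k >= 4] leaves a geometric growth of ratio [beta ^ 2] on the left. *)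
have bk : 2 ^+ 2 <= beta ^+ k.
  have -> : beta ^+ k = 2 `^ (p *+ k).
    by rewrite -[p *+ k]mulr_natr powRrM powR_mulrn ?powR_ge0.
  by rewrite -powR_mulrn// ler_powR ?ler1n.
have X0 : 0 <= sig ^+ k * pnorm D by rewrite mulr_ge0 ?exprn_ge0 ?pnorm_ge0 ?ltW.
move: (sig ^+ k * _) X0 => X X0 le1.
have bk0 : beta ^+ k != 0 by rewrite gt_eqF ?exprn_gt0.
have b20 : (beta ^+ 2) ^+ l != 0 by rewrite gt_eqF ?exprn_gt0 ?exprn_gt0.
have l4 : 0 < (2 ^+ 2) ^+ l :> R by rewrite exprn_gt0 ?exprn_gt0.
rewrite -(ler_pM2l l4) mulrA.
have bkl : (2 ^+ 2) ^+ l <= (beta ^+ k) ^+ l by rewrite lerXn2r ?nnegrE ?exprn_ge0 ?(ltW beta0).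
have bl0 : 0 < (beta ^+ 2) ^+ l by rewrite exprn_gt0 ?exprn_gt0.
apply: (@le_trans _ _ ((beta ^+ 2) ^+ l * ((beta ^+ l) ^+ k * X))).
  rewrite [X in X * _]mulrC -mulrA ler_pM2l// ler_wpM2r//.
  by rewrite [leRHS]exprAC.
rewrite -ler_pdivlMl//; apply: le_trans le1 _.
rewrite [beta ^+ (2 * l)]exprM le_eqVlt; apply/orP; left; apply/eqP; field.
by rewrite -exprM in b20 *; rewrite ?b20 ?gt_eqF.
Qed.

(** If [c = ad_a b] commutes with [a], then [b + n z c] is the conjugate of [b] by
    [(1 + z a) ^ n] up to a factor near [1], as long as [n |z| ^ 2] is small.  With
    [n = 4 ^ l] and [|z|] of order [2 ^ (- l)], [n z c] stays bounded although [n |z|]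
    tends to infinity. *)
Lemma commutator_sqr0 a b :
  commutator a (commutator a b) = 0 -> commutator a b = 0.
Proof.
move=> ac; set c := commutator a b.
pose e := exp_bound.
have e1 : 1 <= e by rewrite /e /exp_bound lerDr pnorm_ge0.
have [|s [s0 sK s1]] := @small_root _ _ p_gt0 (pnorm a + 2 * pnorm (a ^+ 2) * (e + 1)).
  by rewrite addr_ge0 ?mulr_ge0 ?addr_ge0 ?pnorm_ge0//; lra.
set beta := 2 `^ p : R.
set sig := s `^ p in sK s1.
have sig0 : 0 < sig by rewrite powR_gt0.
have beta1 : 1 < beta := two_powR_gt1 p_gt0.
have beta0 : 0 < beta by lra.
apply: pnorm0_eq0; apply/eqP; rewrite eq_le pnorm_ge0 andbT.
suff : sig * pnorm c <= 0 by rewrite pmulr_rle0.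
apply: (@le_of_forall_geometric _ beta _ (2 * ((m + 1) * (pnorm b * e)))) => //.
move=> l; set z : R[i] := (s / 2 ^+ l)%:C%C.
have t0 : 0 < s / 2 ^+ l by rewrite divr_gt0 ?exprn_gt0.
have tE : (s / 2 ^+ l) `^ p = sig / beta ^+ l by rewrite dyadic_powR// ltW.
have nE : (4 ^ l)%:R `^ p = (beta ^+ l) ^+ 2 :> R by rewrite four_powR.
have zE : modulus z `^ p = sig / beta ^+ l by rewrite modulus_real ?(ltW t0).
have bl1 : 1 <= beta ^+ l by rewrite exprn_ege1// ltW.
have bl0 : 0 < beta ^+ l by lra.
case: (4 ^ l)%N (expn_gt0 4 l) nE => [//|n _] nE.
set x := z *: a.
have xc : commutator x b = z *: c by rewrite /x /c /commutator scalerBr scalerAl scalerAr.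
have xxc : commutator x (commutator x b) = 0.
  by rewrite xc {1}/x /commutator -!scalerAl -!scalerAr -!scalerBr -/(commutator a c) ac !scaler0.
have x2 : n.+1%:R `^ p * pnorm (x ^+ 2) = sig ^+ 2 * pnorm (a ^+ 2).
  rewrite /x exprZn pnormZ modulusX exprn_powR ?modulus_ge0// zE nE.
  by field; rewrite gt_eqF.
have px : pnorm x <= sig * pnorm a.
  rewrite /x pnormZ zE ler_wpM2r ?pnorm_ge0// ler_pdivrMr// ler_peMr//; exact: ltW.
have a0 := pnorm_ge0 a; have a20 := pnorm_ge0 (a ^+ 2).
have sa : sig * pnorm a <= 4^-1.
  by apply: le_trans sK; rewrite ler_wpM2l ?(ltW sig0)// lerDl; rewrite ?mulr_ge0//; lra.
have sa2 : 2 * (sig ^+ 2 * pnorm (a ^+ 2)) * (e + 1) <= 4^-1.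
  have -> : 2 * (sig ^+ 2 * pnorm (a ^+ 2)) * (e + 1) =
    sig * (sig * (2 * pnorm (a ^+ 2) * (e + 1))) by ring.
  apply: le_trans sK; rewrite ler_wpM2l ?(ltW sig0)//.
  apply: (@le_trans _ _ (2 * pnorm (a ^+ 2) * (e + 1))); last by rewrite lerDr.
  by rewrite ler_piMl ?mulr_ge0//; lra.
have u0 : 0 <= sig ^+ 2 * pnorm (a ^+ 2) by rewrite mulr_ge0 ?exprn_ge0 ?(ltW sig0).
have small : n.+1%:R `^ p * pnorm (x ^+ 2) <= 2^-1 by rewrite x2; nra.
have small' : n%:R `^ p * pnorm (x ^+ 2) <= n.+1%:R `^ p * pnorm (x ^+ 2).
  rewrite ler_wpM2r ?pnorm_ge0//.
  by rewrite ge0_ler_powR ?nnegrE ?ler0n ?(ltW p_gt0)// ler_nat.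
set w := (1 - x ^+ 2) ^+ n * (1 - x).
have w1 : pnorm (w - 1) <= 2^-1.
  have -> : w - 1 = ((1 - x ^+ 2) ^+ n - 1) * (1 - x) - x.
    by rewrite mulrBl mul1r opprB addrA [RHS]addrAC addrK.
  rewrite (le_trans (pnormB _ _))//.
  have B1 : pnorm ((1 - x ^+ 2) ^+ n - 1) <= 2 * (sig ^+ 2 * pnorm (a ^+ 2)).
    rewrite -x2; apply: le_trans (pnorm_expr1B (le_trans small' small)) _.
    by rewrite ler_pM2l.
  have B2 : pnorm (1 - x) <= e + 1.
    rewrite (le_trans (pnormB _ _))// /e /exp_bound.
    by have := le_trans px sa; lra.
  have := pnormM ((1 - x ^+ 2) ^+ n - 1) (1 - x).
  have := ler_pM (pnorm_ge0 _) (pnorm_ge0 _) B1 B2.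
  have := le_trans px sa; lra.
have cw : pnorm c <= 2 * pnorm (c * w).
  have : pnorm c <= pnorm (c * w) + pnorm c * pnorm (w - 1).
    apply: le_trans (lerD (lexx _) (pnormM _ _)).
    have {1}-> : c = c * w - c * (w - 1) by rewrite mulrBr mulr1 subKr.
    exact: pnormB.
  have := ler_wpM2l (pnorm_ge0 c) w1; lra.
have main : pnorm (z *: (c * w) *+ n.+1) <= (m + 1) * (pnorm b * e).
  have -> : z *: (c * w) *+ n.+1 =
      (1 + x) ^+ n.+1 * b * (1 - x) ^+ n.+1 - b * (1 - x ^+ 2) ^+ n.+1.
    by rewrite conj_commutator// xc -scalerAl addrC addKr.
  rewrite (le_trans (pnormB _ _))// mulrDl mul1r lerD//; first exact: pnorm_conj_le.
  by rewrite (le_trans (pnormM _ _))// ler_wpM2l ?pnorm_ge0//; exact: pnorm_expr1B_le.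
have : beta ^+ l * (sig * pnorm (c * w)) <= (m + 1) * (pnorm b * e).
  apply: le_trans main; rewrite pnormMn pnormZ zE nE le_eqVlt; apply/orP; left.
  by apply/eqP; field; rewrite gt_eqF.
have : beta ^+ l * (sig * pnorm c) <= beta ^+ l * (sig * (2 * pnorm (c * w))).
  by rewrite ler_pM2l// ler_pM2l.
set B := (m + 1) * _; nra.
Qed.

(** Starting from a large [k], [ad_a ^ k b = 0] implies [ad_a ^ (k - 1) b = 0] as long
    as [k >= 2]. *)
Theorem commutative_of_norm_sqr a b : a * b = b * a.
Proof.
have [k pk] : exists k, 2 <= p *+ k.
  apply: contrapT => /forallNP H; have := p_gt0; rewrite ltNge => /negP; apply.
  apply: (@le_of_forall_mulrn _ _ 2) => n; have /negP := H n.
  by rewrite -ltNge => /ltW.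
have := commutator_nilpotent a b pk.
elim: k {pk} => [|k IH]; first by move=> /= ->; rewrite mulr0 mul0r.
case: k IH => [_ /= /eqP|k IH]; first by rewrite subr_eq0 => /eqP.
by move=> H; apply: IH; rewrite iterS; apply: commutator_sqr0.
Qed.

End commutativity.

(** * The spectral radius *)

(** Only inequalities that pass to infima of families are recorded; the reverse
    ones follow from them. *)
Record spectral_seminorm (R : realType) (A : algType R[i]) (q : A -> R) : Prop :=
  SpectralSeminorm {
    spectral_ge0 : forall x, 0 <= q x ;
    spectralD : forall x y, q (x + y) <= q x + q y ;
    spectralZ : forall (z : R[i]) x, q (z *: x) <= modulus z * q x ;
    spectralM : forall x y, q (x * y) <= q x * q y ;
    spectral_sqr : forall x, q x ^+ 2 <= q (x ^+ 2) ;
    spectral1_ge1 : 1 <= q 1 }.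

Section spectral_radius.
Context (R : realType) (p : R) (p_gt0 : 0 < p).
Context (A : pBanachAlgType p).
Context (m : R) (m_gt0 : 0 < m)
  (norm_sqr : forall a : A, pnorm a ^+ 2 <= m * pnorm (a ^+ 2))
  (A_comm : forall a b : A, a * b = b * a).
Implicit Types (a b x y : A).

Let p0 : 0 <= p^-1. Proof. by rewrite invr_ge0 ltW. Qed.

Let pneq0 : p != 0. Proof. by rewrite gt_eqF. Qed.

(** Homogeneous of degree one, but in general not subadditive when [p < 1]. *)
Definition hnorm a := pnorm a `^ p^-1.

Lemma hnorm_ge0 a : 0 <= hnorm a. Proof. exact: powR_ge0. Qed.

Lemma hnormK a : hnorm a `^ p = pnorm a.
Proof. by rewrite -powRrM mulVf ?gt_eqF// powRr1 ?pnorm_ge0. Qed.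

Lemma hnormM a b : hnorm (a * b) <= hnorm a * hnorm b.
Proof.
rewrite /hnorm -powRM ?pnorm_ge0// ge0_ler_powR ?nnegrE ?mulr_ge0 ?pnorm_ge0//.
exact: pnormM.
Qed.

Lemma hnormZ (z : R[i]) a : hnorm (z *: a) = modulus z * hnorm a.
Proof.
rewrite /hnorm pnormZ powRM ?powR_ge0 ?pnorm_ge0// -powRrM mulfV ?gt_eqF//.
by rewrite powRr1// modulus_ge0.
Qed.

Lemma hnorm1_ge1 : 1 <= hnorm (1 : A).
Proof.
have -> : 1 = 1 `^ p^-1 :> R by rewrite powR1.
rewrite ge0_ler_powR ?nnegrE ?pnorm_ge0//; exact: pnorm1_ge1.
Qed.

Lemma constant_ge1 : 1 <= m.
Proof.
have n1 := pnorm1_ge1 A; have := norm_sqr 1; rewrite expr1n; nra.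
Qed.

Definition root_norm n a := hnorm (a ^+ (2 ^ n)) `^ (2 ^ n)%:R^-1.

Lemma root_norm_ge0 n a : 0 <= root_norm n a. Proof. exact: powR_ge0. Qed.

Lemma root_normX n a : root_norm n a ^+ (2 ^ n) = hnorm (a ^+ (2 ^ n)).
Proof.
by rewrite -powR_mulrn ?root_norm_ge0// -powRrM mulVf ?powRr1 ?hnorm_ge0//.
Qed.

Lemma le_root_norm n a (c : R) : 0 <= c ->
  (c <= root_norm n a) = (c ^+ (2 ^ n) <= hnorm (a ^+ (2 ^ n))).
Proof.
by move=> c0; rewrite -root_normX ler_pXn2r ?nnegrE ?root_norm_ge0 ?expn_gt0.
Qed.

Lemma ge_root_norm n a (c : R) : 0 <= c ->
  (root_norm n a <= c) = (hnorm (a ^+ (2 ^ n)) <= c ^+ (2 ^ n)).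
Proof.
by move=> c0; rewrite -root_normX ler_pXn2r ?nnegrE ?root_norm_ge0 ?expn_gt0.
Qed.

Lemma root_norm_le i j a : (i <= j)%N -> root_norm j a <= root_norm i a.
Proof.
move=> /subnK <-; elim: (j - i)%N => [//|k]; apply: le_trans.
rewrite addSn ge_root_norm ?root_norm_ge0// expnSr !exprM root_normX.
by rewrite expr2 (le_trans (hnormM _ _)).
Qed.

Lemma root_normM n a b : root_norm n (a * b) <= root_norm n a * root_norm n b.
Proof.
rewrite ge_root_norm ?mulr_ge0 ?root_norm_ge0// exprMn_comm; last exact: A_comm.
rewrite [leRHS]exprMn [X in _ <= X * _]root_normX [X in _ <= _ * X]root_normX.
exact: hnormM.
Qed.

Lemma root_normZ n (z : R[i]) a : root_norm n (z *: a) = modulus z * root_norm n a.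
Proof.
have rz0 := mulr_ge0 (modulus_ge0 z) (root_norm_ge0 n a).
have E : hnorm ((z *: a) ^+ (2 ^ n)) = (modulus z * root_norm n a) ^+ (2 ^ n).
  by rewrite [RHS]exprMn root_normX exprZn hnormZ modulusX.
by apply/eqP; rewrite eq_le ge_root_norm ?le_root_norm// E lexx.
Qed.

Lemma root_norm_sqr n a : root_norm n (a ^+ 2) = root_norm n.+1 a ^+ 2.
Proof.
apply/eqP; rewrite eq_le ge_root_norm ?le_root_norm ?exprn_ge0 ?root_norm_ge0//.
by rewrite -!exprM -expnS root_normX lexx.
Qed.

Lemma hnorm_le_root_norm n a : hnorm a <= m `^ p^-1 * root_norm n a.
Proof.
have mp0 : 0 < m `^ p^-1 by rewrite powR_gt0.
rewrite mulrC -ler_pdivrMr// le_root_norm ?divr_ge0 ?hnorm_ge0 ?(ltW mp0)//.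
rewrite [leLHS]expr_div_n ler_pdivrMr ?exprn_gt0// mulrC -!exprn_powR ?pnorm_ge0 ?(ltW m_gt0)//.
rewrite -powRM ?exprn_ge0 ?pnorm_ge0 ?(ltW m_gt0)//.
rewrite ge0_ler_powR ?nnegrE ?mulr_ge0 ?exprn_ge0 ?pnorm_ge0 ?(ltW m_gt0)//.
apply: le_trans (pnorm_expr2 m_gt0 norm_sqr a n).
by rewrite ler_peMl ?exprn_ge0 ?pnorm_ge0// constant_ge1.
Qed.

Local Open Scope classical_set_scope.

(** The radius [lim |a ^ n| ^ (1 / (p n))]; along [n = 2 ^ j] the sequence is
    nonincreasing, so that its limit is an infimum. *)
Definition spectral_radius a : R := inf (range (root_norm^~ a)).
Notation rho := spectral_radius.

Lemma root_norm_nneg a : nneg_set (range (root_norm^~ a)).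
Proof.
split; first by exists (root_norm 0 a), 0%N.
by move=> _ [n _ <-]; exact: root_norm_ge0.
Qed.
Local Hint Resolve root_norm_nneg : core.

Lemma spectral_radius_le n a : rho a <= root_norm n a.
Proof. by apply: nneg_inf_le => //; exists n. Qed.

Lemma spectral_radius_ge0 a : 0 <= rho a. Proof. exact: nneg_inf_ge0. Qed.

Lemma spectral_radius_le_hnorm a : rho a <= hnorm a.
Proof.
apply: le_trans (spectral_radius_le 0 a) _; by rewrite /root_norm expn0 expr1 invr1 powRr1 ?hnorm_ge0.
Qed.

Lemma hnorm_le_spectral_radius a : hnorm a <= m `^ p^-1 * rho a.
Proof.
apply: le_inf_mull => //; first exact: powR_ge0.
by move=> _ [n _ <-]; exact: hnorm_le_root_norm.
Qed.

Lemma spectral_radiusM a b : rho (a * b) <= rho a * rho b.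
Proof.
apply: le_inf_mul => // _ _ [i _ <-] [j _ <-].
apply: le_trans (spectral_radius_le (maxn i j) _) (le_trans (root_normM _ _ _) _).
apply: ler_pM; [exact: root_norm_ge0|exact: root_norm_ge0|apply: root_norm_le..].
  exact: leq_maxl.
exact: leq_maxr.
Qed.

Lemma spectral_radiusZ (z : R[i]) a : rho (z *: a) <= modulus z * rho a.
Proof.
apply: le_inf_mull => //; first exact: modulus_ge0.
by move=> _ [n _ <-]; rewrite -root_normZ spectral_radius_le.
Qed.

Lemma spectral_radius_sqr a : rho a ^+ 2 <= rho (a ^+ 2).
Proof.
apply: lb_le_inf; first by have [] := root_norm_nneg (a ^+ 2).
move=> _ [n _ <-]; rewrite root_norm_sqr lerXn2r ?nnegrE ?spectral_radius_ge0 ?root_norm_ge0//.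
exact: spectral_radius_le.
Qed.

Lemma spectral_radius1_ge1 : 1 <= rho 1.
Proof.
apply: lb_le_inf; first by have [] := root_norm_nneg 1.
by move=> _ [n _ <-]; rewrite le_root_norm// !expr1n hnorm1_ge1.
Qed.

(* Unification must not unfold the infimum. *)
Local Opaque spectral_radius.

Lemma spectral_radius_expr2 a j : rho a ^+ (2 ^ j) <= rho (a ^+ (2 ^ j)).
Proof.
elim: j => [|j IH]; first by rewrite !expr1.
rewrite expnSr !exprM; apply: le_trans (spectral_radius_sqr _).
by rewrite lerXn2r ?nnegrE ?exprn_ge0 ?spectral_radius_ge0.
Qed.

Lemma spectral_radiusX a n : rho (a ^+ n) <= rho a ^+ n.
Proof.
elim: n => [|n IH].
  have H := spectral_radius_sqr 1; rewrite (expr1n A 2) in H.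
  rewrite [X in rho X]expr0 [leRHS]expr0.
  by move: (rho 1) spectral_radius1_ge1 H => r; nra.
rewrite [X in rho X]exprS [leRHS]exprS; apply: le_trans (spectral_radiusM _ _) _.
by apply: ler_wpM2l IH; exact: spectral_radius_ge0.
Qed.

Lemma pnorm_le_spectral_radius a : pnorm a <= m * rho a `^ p.
Proof.
rewrite -hnormK -[X in _ <= X * _](powRr1 (ltW m_gt0)) -(mulVf pneq0) powRrM.
rewrite -powRM ?powR_ge0 ?spectral_radius_ge0// ge0_ler_powR ?nnegrE ?hnorm_ge0 ?mulr_ge0 ?powR_ge0 ?spectral_radius_ge0 ?(ltW p_gt0)//.
exact: hnorm_le_spectral_radius.
Qed.

(** The [p]-th powers of the binomial coefficients in the [p]-norm of
    [(x + y) ^ N] are exactly what the [p]-th power of [(rho x + rho y) ^ N]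
    contains, and the number [N + 1] of terms disappears in the limit. *)
Lemma spectral_radiusD a b : rho (a + b) <= rho a + rho b.
Proof.
have ab0 : 0 <= rho a + rho b by rewrite addr_ge0 ?spectral_radius_ge0.
rewrite -[leLHS]powRr1 ?spectral_radius_ge0// -[leRHS]powRr1// -(mulfV pneq0) !powRrM.
rewrite ge0_ler_powR ?nnegrE ?powR_ge0//.
apply: (@le_of_forall_expr _ _ _ (m ^+ 2)); first exact: powR_ge0.
move=> j; set N := (2 ^ j)%N.
rewrite -!exprn_powR ?spectral_radius_ge0//.
apply: (@le_trans _ _ (pnorm ((a + b) ^+ N))).
  rewrite -hnormK ge0_ler_powR ?nnegrE ?exprn_ge0 ?hnorm_ge0 ?spectral_radius_ge0 ?(ltW p_gt0)//.
  exact: le_trans (spectral_radius_expr2 _ _) (spectral_radius_le_hnorm _).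
rewrite exprDn_comm; last exact: A_comm.
rewrite (le_trans (pnorm_sum p_gt0 _ _ _))//.
apply: (@le_trans _ _ (\sum_(i < N.+1) m ^+ 2 * ((rho a + rho b) ^+ N) `^ p)); last first.
  by rewrite sumr_const card_ord -[leLHS]mulr_natl [leLHS]mulrCA [leLHS]mulrA.
apply: ler_sum => i _; rewrite pnormMn.
apply: (@le_trans _ _ ('C(N, i)%:R `^ p * ((m * (rho a ^+ (N - i)) `^ p) * (m * (rho b ^+ i) `^ p)))).
  rewrite ler_wpM2l ?powR_ge0// (le_trans (pnormM _ _))//.
  have H c k : pnorm (c ^+ k) <= m * (rho c ^+ k) `^ p.
    rewrite (le_trans (pnorm_le_spectral_radius _))// ler_pM2l// ge0_ler_powR ?nnegrE ?exprn_ge0 ?spectral_radius_ge0 ?(ltW p_gt0)//.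
    exact: spectral_radiusX.
  by rewrite ler_pM ?pnorm_ge0.
rewrite (_ : _ * _ = m ^+ 2 * ('C(N, i)%:R `^ p * (rho a ^+ (N - i)) `^ p * (rho b ^+ i) `^ p)); last by ring.
rewrite ler_wpM2l ?exprn_ge0 ?(ltW m_gt0)//.
rewrite -!powRM ?mulr_ge0 ?exprn_ge0 ?spectral_radius_ge0//.
rewrite ge0_ler_powR ?nnegrE ?mulr_ge0 ?exprn_ge0 ?spectral_radius_ge0 ?(ltW p_gt0)//.
by rewrite binomial_term_le ?spectral_radius_ge0.
Qed.

Lemma spectral_radius_seminorm : spectral_seminorm rho.
Proof.
split; [exact: spectral_radius_ge0|exact: spectral_radiusD|exact: spectral_radiusZ|exact: spectral_radiusM|exact: spectral_radius_sqr|exact: spectral_radius1_ge1].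
Qed.

End spectral_radius.

(** * Multiplicative seminorms *)

Section minimal_seminorms.
Context (R : realType) (A : algType R[i]) (A_comm : forall x y : A, x * y = y * x).
Implicit Types (x y b : A) (q : A -> R).
Local Open Scope classical_set_scope.

Definition inf_fun (E : set (A -> R)) x : R := inf [set q x | q in E].

(** The members of the family need not be seminorms: sums and products may be
    estimated by another member, as happens for decreasing sequences. *)
Lemma inf_spectral (E : set (A -> R)) : E !=set0 ->
  (forall q x, E q -> 0 <= q x) ->
  (forall q r, E q -> E r -> exists2 t, E t & forall x y, t (x + y) <= q x + r y) ->
  (forall q (z : R[i]) x, E q -> q (z *: x) <= modulus z * q x) ->
  (forall q r, E q -> E r -> exists2 t, E t & forall x y, t (x * y) <= q x * r y) ->
  (forall q x, E q -> q x ^+ 2 <= q (x ^+ 2)) ->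
  (forall q, E q -> 1 <= q 1) ->
  spectral_seminorm (inf_fun E).
Proof.
move=> [q0 Eq0] E0 ED EZ EM E2 E1.
have nn x : nneg_set [set q x | q in E].
  by split=> [|_ [q Eq <-]]; [exists (q0 x), q0|exact: E0].
have le q x : E q -> inf_fun E x <= q x by move=> Eq; apply: nneg_inf_le => //; exists q.
split.
- by move=> x; exact: nneg_inf_ge0.
- move=> x y; apply: le_inf_add => // _ _ [q Eq <-] [r Er <-].
  by have [t Et] := ED _ _ Eq Er => /(_ x y); apply: le_trans; exact: le.
- move=> z x; apply: le_inf_mull => //; first exact: modulus_ge0.
  by move=> _ [q Eq <-]; apply: le_trans (EZ _ _ _ Eq); exact: le.
- move=> x y; apply: le_inf_mul => // _ _ [q Eq <-] [r Er <-].
  by have [t Et] := EM _ _ Eq Er => /(_ x y); apply: le_trans; exact: le.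
- move=> x; apply: lb_le_inf; first by have [] := nn (x ^+ 2).
  move=> _ [q Eq <-]; apply: le_trans (E2 _ _ Eq).
  by rewrite lerXn2r ?nnegrE ?nneg_inf_ge0// ?E0//; exact: le.
- by apply: lb_le_inf; [have [] := nn 1|move=> _ [q Eq <-]; exact: E1].
Qed.

Lemma spectral_expr2 q x j : spectral_seminorm q -> q x ^+ (2 ^ j) <= q (x ^+ (2 ^ j)).
Proof.
move=> sq; elim: j => [|j IH]; first by rewrite !expr1.
rewrite expnSr !exprM; apply: le_trans (spectral_sqr sq _).
by rewrite lerXn2r ?nnegrE ?exprn_ge0 ?(spectral_ge0 sq).
Qed.

Section smoothing.
Context (q : A -> R) (sq : spectral_seminorm q) (b : A) (qb0 : 0 < q b).

Let term n x := q (x * b ^+ n) / q b ^+ n.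

Let term_ge0 n x : 0 <= term n x.
Proof. by rewrite divr_ge0 ?exprn_ge0 ?(spectral_ge0 sq). Qed.

Let term_le i j x : (i <= j)%N -> term j x <= term i x.
Proof.
move=> /subnK <-; elim: (j - i)%N => [//|k]; apply: le_trans.
rewrite addSn /term exprSr mulrA ler_pdivrMr ?exprn_gt0//.
rewrite (le_trans (spectralM sq _ _))// exprSr mulrA divfK// gt_eqF// exprn_gt0//.
Qed.

Definition smoothing := inf_fun (range term).

Lemma smoothing_le_term n x : smoothing x <= term n x.
Proof.
apply: nneg_inf_le; last by exists (term n) => //; exists n.
split; first by exists (term 0 x), (term 0) => //; exists 0%N.
by move=> _ [_ [k _ <-] <-].
Qed.

(** The limit of [q (x b ^ n) / q b ^ n]: a seminorm below [q] which multiplication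
    by [b] dilates by the factor [q b]. *)
Lemma smoothing_spectral : spectral_seminorm smoothing.
Proof.
apply: inf_spectral.
- by exists (term 0), 0%N.
- by move=> _ x [n _ <-].
- move=> _ _ [i _ <-] [j _ <-]; exists (term (i + j)); first by exists (i + j)%N.
  move=> x y; apply: (@le_trans _ _ (term (i + j) x + term (i + j) y)).
    rewrite -mulrDl ler_wpM2r ?invr_ge0 ?exprn_ge0 ?(ltW qb0)//.
    by rewrite mulrDl; exact: spectralD.
  by rewrite lerD// term_le ?leq_addr ?leq_addl.
- move=> _ z x [n _ <-]; rewrite /term mulrA ler_wpM2r ?invr_ge0 ?exprn_ge0 ?(ltW qb0)//.
  by rewrite -scalerAl; exact: spectralZ.
- move=> _ _ [i _ <-] [j _ <-]; exists (term (i + j)); first by exists (i + j)%N.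
  move=> x y; rewrite /term mulrACA -invfM -exprD ler_wpM2r ?invr_ge0 ?exprn_ge0 ?(ltW qb0)//.
  apply: le_trans (spectralM sq _ _).
  by rewrite exprD -!mulrA [y * _]A_comm -!mulrA [b ^+ j * y]A_comm.
- move=> _ x [n _ <-]; apply: (@le_trans _ _ (term (n + n) (x ^+ 2))).
    have -> : term (n + n) (x ^+ 2) = q ((x * b ^+ n) ^+ 2) / (q b ^+ n) ^+ 2.
      rewrite /term -(exprM (q b)) muln2 addnn exprMn_comm; last exact: A_comm.
      by rewrite -(exprM b) muln2.
    rewrite /term expr_div_n ler_wpM2r ?invr_ge0 ?exprn_ge0 ?(ltW qb0)//.
    exact: spectral_sqr.
  by rewrite term_le// leq_addr.
- move=> _ [n _ <-]; rewrite /term mul1r ler_pdivlMr ?exprn_gt0// mul1r.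
  have n2 : (n <= 2 ^ n)%N by rewrite ltnW// ltn_expl.
  rewrite -(ler_pM2r (exprn_gt0 (2 ^ n - n) qb0)) -exprD subnKC//.
  apply: le_trans (spectral_expr2 b n sq) _.
  rewrite -{1}(subnKC n2) exprD (le_trans (spectralM sq _ _))// ler_wpM2l ?(spectral_ge0 sq)//.
  elim: (2 ^ n - n)%N => [|k IH]; last first.
    by rewrite !exprS (le_trans (spectralM sq _ _))// ler_pM2l.
  have := spectral_sqr sq 1; have := spectral1_ge1 sq; rewrite !expr0 expr1n; nra.
Qed.

Lemma smoothing_le x : smoothing x <= q x.
Proof. by have := smoothing_le_term 0 x; rewrite /term !expr0 mulr1 divr1. Qed.

Lemma le_smoothing x (c : R) : (forall n, c <= term n x) -> c <= smoothing x.
Proof.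
move=> H; apply: lb_le_inf; first by exists (term 0 x), (term 0) => //; exists 0%N.
by move=> _ [_ [k _ <-] <-].
Qed.

Lemma smoothing_self x : q b * smoothing x <= smoothing (b * x).
Proof.
apply: le_smoothing => n; rewrite -ler_pdivlMl//.
apply: le_trans (smoothing_le_term n.+1 x) _.
by rewrite /term exprS mulrA [x * b]A_comm exprS invfM mulrCA.
Qed.

Lemma smoothing_homothety a c : 0 <= c ->
  (forall x, c * q x <= q (a * x)) -> forall x, c * smoothing x <= smoothing (a * x).
Proof.
move=> c0 H x; apply: le_smoothing => n.
apply: (@le_trans _ _ (c * term n x)); first by rewrite ler_wpM2l// smoothing_le_term.
by rewrite /term mulrA ler_wpM2r ?invr_ge0 ?exprn_ge0 ?(ltW qb0)// -mulrA H.
Qed.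

End smoothing.

Context (rho : A -> R) (srho : spectral_seminorm rho).

(** A minimal seminorm below [rho] among those that multiplication by [a]
    dilates by [rho a] equals all its smoothings, hence is multiplicative. *)
Lemma exists_multiplicative a : 0 < rho a -> exists q, [/\ spectral_seminorm q,
  (forall x y, q (x * y) = q x * q y), (forall x, q x <= rho x) & q a = rho a].
Proof.
move=> ra.
pose P q := [/\ spectral_seminorm q, (forall x, q x <= rho x)
  & forall x, rho a * q x <= q (a * x)].
have P0 : P (smoothing rho a).
  by split; [exact: smoothing_spectral|exact: smoothing_le|exact: smoothing_self].
pose ge (s t : {q | P q}) := `[< forall x, sval t x <= sval s x >].
have [||||t tmax] := @Zorn {q | P q} ge.
- by move=> t; apply/asboolP.
- by move=> r s t /asboolP rs /asboolP st; apply/asboolP => x; exact: le_trans (st x) (rs x).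
- move=> [s Ps] [t Pt] /asboolP /= st /asboolP /= ts; apply: eq_exist.
  by apply/funext => x; apply/eqP; rewrite eq_le st ts.
- move=> F Ftot; have [[s0 Fs0]|F0] := pselect (F !=set0); last first.
    by exists (exist _ _ P0) => s Fs; case: F0; exists s.
  pose E := [set sval s | s in F].
  have EP q : E q -> P q by move=> [s _ <-]; exact: svalP.
  have Emin q r : E q -> E r -> exists2 t, E t & (forall x, t x <= q x) /\ (forall x, t x <= r x).
    move=> [s Fs <-] [t Ft <-]; have [/asboolP st|/asboolP ts] := Ftot _ _ Fs Ft.
      by exists (sval t); [exists t|split].
    by exists (sval s); [exists s|split].
  have En : E !=set0 by exists (sval s0), s0.
  have E0 q x : E q -> 0 <= q x by move=> /EP[/spectral_ge0].
  have le q x : E q -> inf_fun E x <= q x.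
    move=> Eq; apply: nneg_inf_le; last by exists q.
    by split; [exists (q x), q|move=> _ [r Er <-]; exact: E0].
  have PE : P (inf_fun E).
    split.
    + apply: inf_spectral => //.
      * move=> q r Eq Er; have [t Et [tq tr]] := Emin _ _ Eq Er; exists t => // x y.
        by have [/spectralD tD _ _] := EP _ Et; rewrite (le_trans (tD _ _))// lerD.
      * by move=> q z x /EP[/spectralZ].
      * move=> q r Eq Er; have [t Et [tq tr]] := Emin _ _ Eq Er; exists t => // x y.
        by have [/spectralM tM _ _] := EP _ Et; rewrite (le_trans (tM _ _))// ler_pM ?E0.
      * by move=> q x /EP[/spectral_sqr].
      * by move=> q /EP[/spectral1_ge1].
    + by move=> x; case: En => q Eq; have [_ /(_ x) + _] := EP _ Eq; apply: le_trans; exact: le.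
    + move=> x; apply: lb_le_inf; first by case: En => q Eq; exists (q (a * x)), q.
      move=> _ [q Eq <-]; have [_ _ /(_ x)] := EP _ Eq; apply: le_trans.
      by rewrite ler_pM2l// le.
  by exists (exist _ _ PE) => s Fs; apply/asboolP => x /=; apply: le; exists s.
case: t tmax => q Pq tmax; have [sq qrho qa] := Pq.
have mul x y : q (x * y) = q x * q y.
  apply/eqP; rewrite eq_le (spectralM sq)/=.
  have [->|qx] := eqVneq (q x) 0; first by rewrite mul0r (spectral_ge0 sq).
  have {}qx : 0 < q x by rewrite lt_def qx (spectral_ge0 sq).
  have Px : P (smoothing q x).
    split; first exact: smoothing_spectral.
      by move=> u; exact: le_trans (smoothing_le sq x u) (qrho u).
    exact: (smoothing_homothety sq qx (ltW ra) qa).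
  have /tmax/(congr1 sval)/= qE : ge (exist _ _ Pq) (exist _ _ Px).
    by apply/asboolP => u /=; exact: smoothing_le.
  by have := smoothing_self sq qx y; rewrite qE.
exists q; split=> //; apply/eqP; rewrite eq_le qrho/=.
have := qa 1; rewrite mulr1; apply: le_trans.
by rewrite ler_peMr ?(ltW ra) ?(spectral1_ge1 sq).
Qed.

End minimal_seminorms.

(** * From multiplicative seminorms to characters *)

Section gelfand_mazur.
Context (R : realType) (A : algType R[i]) (A_comm : forall x y : A, x * y = y * x).
Context (q : A -> R) (sq : spectral_seminorm q)
  (qM : forall x y, q (x * y) = q x * q y).
Implicit Types (x y : A) (z w : R[i]).

Let q_ge0 x : 0 <= q x. Proof. exact: spectral_ge0. Qed.

Lemma mult_seminorm1 : q 1 = 1.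
Proof. by have := spectral1_ge1 sq; have := qM 1 1; rewrite mulr1; nra. Qed.

Lemma mult_seminormZ z x : q (z *: x) = modulus z * q x.
Proof.
apply/eqP; rewrite eq_le (spectralZ sq)/=.
have [->|z0] := eqVneq z 0; first by rewrite modulus0 mul0r.
have mz := modulus_gt0 z0.
rewrite mulrC -ler_pdivlMr// mulrC -modulusV.
by apply: le_trans (spectralZ sq _ _); rewrite scalerA mulVf// scale1r.
Qed.

Lemma mult_seminorm_alg z : q z%:A = modulus z.
Proof. by rewrite mult_seminormZ mult_seminorm1 mulr1. Qed.

Lemma mult_seminormN x : q (- x) = q x.
Proof. by rewrite -scaleN1r mult_seminormZ modulusN modulus1 mul1r. Qed.

Lemma mult_seminormB x y : q (x - y) <= q x + q y.
Proof. by rewrite (le_trans (spectralD sq _ _))// mult_seminormN. Qed.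

Lemma mult_seminormX x n : q (x ^+ n) = q x ^+ n.
Proof.
elim: n => [|n IH]; first by rewrite [X in q X]expr0 mult_seminorm1 [RHS]expr0.
by rewrite [X in q X]exprS qM IH [RHS]exprS.
Qed.

Lemma modulusB_le x z w : modulus (z - w) <= q (x - z%:A) + q (x - w%:A).
Proof.
rewrite -mult_seminorm_alg scalerBl [leRHS]addrC.
have -> : z%:A - w%:A = (x - w%:A) - (x - z%:A).
  by rewrite opprB [RHS]addrC addrA subrK.
exact: mult_seminormB.
Qed.

Lemma subr_sqr_alg x w : x ^+ 2 - (w ^+ 2)%:A = (x - w%:A) * (x + w%:A).
Proof.
rewrite mulrDr !mulrBl mulr_algl mulr_algr mulr_algl scalerA -!expr2.
by rewrite addrA subrK.
Qed.

Section distance.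
Context (mu : R) (mu_gt0 : 0 < mu).

(** Taking square roots repeatedly, [y ^ (2 ^ s) - v] splits into [2 ^ s] factors
    [y - z], each of seminorm at least [mu]. *)
Lemma expr_distance_ge y s v : (forall z, mu <= q (y - z%:A)) ->
  mu ^+ (2 ^ s) <= q (y ^+ (2 ^ s) - v%:A).
Proof.
move=> H; elim: s v => [|s IH] v; first by rewrite !expr1.
rewrite -(sqrtCK v) expnSr !exprM subr_sqr_alg qM expr2.
rewrite ler_pM ?exprn_ge0 ?(ltW mu_gt0)//.
by rewrite -[X in _ + X]opprK -scaleNr.
Qed.

(** All but one of the factors of [y ^ N - w ^ N] are at least [mu]. *)
Lemma factor_distance y s w : (forall z, mu <= q (y - z%:A)) ->
  q (y - w%:A) * mu ^+ (2 ^ s) <= q (y ^+ (2 ^ s) - (w ^+ (2 ^ s))%:A) * mu.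
Proof.
move=> H; elim: s => [|s IH]; first by rewrite !expr1.
rewrite expnSr !exprM subr_sqr_alg qM expr2 [leLHS]mulrA [leRHS]mulrAC.
rewrite ler_pM ?mulr_ge0 ?exprn_ge0 ?(ltW mu_gt0)//.
by rewrite -[X in _ + X]opprK -scaleNr expr_distance_ge.
Qed.

End distance.

(** If the distance [mu] from [x] to the scalars were positive, then [x - z] could
    be moved by any scalar [w] with [|w| = mu / 2] without leaving the
    neighbourhood of the minimum: [mu ^ (N - 1) q (y - w) <= q (y ^ N - w ^ N)] is
    at most [q y ^ N + (mu / 2) ^ N].  Nine such moves go further than [4 mu]. *)
Lemma near_minimum x (mu : R) : 0 < mu -> (forall z, mu <= q (x - z%:A)) ->
    (forall d : R, 0 < d -> exists z, q (x - z%:A) <= (1 + d) * mu) ->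
  forall w, modulus w = mu / 2 -> forall k (d : R), 0 < d -> d <= 1 ->
  exists z, q (x - z%:A) <= (1 + d) * mu /\ q (x - z%:A - (w *+ k)%:A) <= (1 + d) * mu.
Proof.
move=> mu0 Hmu Hd w wmu; elim=> [|k IH] d d0 d1.
  by have [z zd] := Hd d d0; exists z; rewrite mulr0n scale0r subr0.
have [s ds] : exists s, (2^-1) ^+ (2 ^ s) <= d / 2 :> R.
  apply: contrapT => /forallNP Hs.
  suff : d / 2 <= 0 by lra.
  apply: (@le_of_forall_geometric _ 2 _ 1); first by rewrite ltr1n.
  move=> n; have /negP := Hs n; rewrite -ltNge => /ltW Hn.
  have n2 : (n <= 2 ^ n)%N by rewrite ltnW// ltn_expl.
  apply: (@le_trans _ _ (2 ^+ (2 ^ n) * (d / 2))).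
    by rewrite ler_wpM2r ?divr_ge0 ?(ltW d0)// ler_weXn2l// ler1n.
  have := ler_wpM2l (exprn_ge0 (2 ^ n) (ler0n R 2)) Hn.
  by rewrite -[X in _ <= X]exprMn mulfV ?expr1n// pnatr_eq0.
set N := (2 ^ s)%N in ds.
have X1 : 1 <= 2 ^+ N :> R by rewrite exprn_ege1// ler1n.
have X0 : 0 < 2 ^+ N :> R by lra.
pose h : R := d / 2 / 2 ^+ N.
have h0 : 0 < h by rewrite !divr_gt0.
have hd : h <= d / 2 by rewrite ler_pdivrMr// ler_peMr//; lra.
have hN : (1 + h) ^+ N <= 1 + d / 2.
  apply: le_trans (expr1D_le N (ltW h0) _) _; first by lra.
  have : h * 2 ^+ N = d / 2 by rewrite divfK// gt_eqF.
  by rewrite lerD2l mulrBr mulr1 => ->; lra.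
have [|z [z1 z2]] := IH h h0; first by lra.
exists z; split; first by apply: le_trans z1 _; rewrite ler_pM2r//; lra.
set y := x - z%:A - (w *+ k)%:A in z2.
have yE v : y - v%:A = x - (z + w *+ k + v)%:A.
  by rewrite !scalerDl !opprD !addrA.
have -> : x - z%:A - (w *+ k.+1)%:A = y - w%:A.
  by rewrite /y mulrSr scalerDl opprD addrA.
have Hy v : mu <= q (y - v%:A) by rewrite yE.
have muN : 0 < mu ^+ N by rewrite exprn_gt0.
have := factor_distance mu0 s w Hy; rewrite -/N => le1.
have le2 : q (y ^+ N - (w ^+ N)%:A) <= ((1 + d / 2) + d / 2) * mu ^+ N.
  apply: le_trans (mult_seminormB _ _) _.
  rewrite mult_seminorm_alg mult_seminormX modulusX wmu.
  rewrite [_ * mu ^+ N]mulrDl lerD//.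
    apply: (@le_trans _ _ (((1 + h) * mu) ^+ N)).
      by rewrite lerXn2r ?nnegrE ?mulr_ge0 ?addr_ge0 ?(ltW mu0) ?(ltW h0).
    by rewrite [leLHS]exprMn ler_pM2r.
  by rewrite [leLHS]exprMn mulrC ler_pM2r.
rewrite -(ler_pM2r muN) (le_trans le1)//.
rewrite [leRHS]mulrAC ler_pM2r// (le_trans le2)// ler_pM2r//; lra.
Qed.

Local Open Scope classical_set_scope.

Lemma spectrum_nonempty x : exists z, q (x - z%:A) = 0.
Proof.
pose E := range (fun z => q (x - z%:A)).
have En : E !=set0 by exists (q (x - 0%:A)), 0.
have nE : nneg_set E by split=> // _ [z _ <-].
pose mu := inf E.
have mu_le z : mu <= q (x - z%:A) by apply: nneg_inf_le => //; exists z.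
have mu0 : mu <= 0.
  rewrite leNgt; apply/negP => mu0.
  have Hd (d : R) : 0 < d -> exists z, q (x - z%:A) <= (1 + d) * mu.
    move=> d0; have hinf : has_inf E by split=> //; exists 0 => _ [z _ <-].
    have [_ [z _ <-] lt1] := inf_adherent (mulr_gt0 d0 mu0) hinf.
    exists z; rewrite mulrDl mul1r; exact: ltW.
  have mu2 : 0 <= mu / 2 by lra.
  have [z [z1 z2]] := @near_minimum x mu mu0 mu_le Hd _ (modulus_real mu2) 9 1 ltr01 (lexx 1).
  have w9 : modulus ((mu / 2)%:C%C *+ 9) = 9 * (mu / 2).
    by rewrite -[_ *+ 9]mulr_natl modulusM modulus_nat modulus_real.
  have := mult_seminormB (x - z%:A) (x - z%:A - ((mu / 2)%:C%C *+ 9)%:A).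
  rewrite subKr mult_seminorm_alg w9; lra.
(* The distance is attained: the real numbers [Re z - q (x - z)] are below all
   [Re z' + q (x - z')], and likewise for the imaginary parts. *)
have coord (g : R[i] -> R) : (forall z w, g z - g w <= modulus (z - w)) ->
    exists c, forall z, `|c - g z| <= q (x - z%:A).
  move=> gl; pose F := range (fun z => g z - q (x - z%:A)).
  have key z w : g z - q (x - z%:A) <= g w + q (x - w%:A).
    have := gl z w; have := modulusB_le x z w; lra.
  have ubF w : ubound F (g w + q (x - w%:A)) by move=> _ [z _ <-]; exact: key.
  have supF : has_sup F.
    split; first by exists (g 0 - q (x - 0%:A)), 0.
    by exists (g 0 + q (x - 0%:A)); exact: ubF.
  exists (sup F) => z; rewrite ler_distl; apply/andP; split.
    by apply: ub_le_sup; [case: supF|exists z].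
  by apply: ge_sup => //; case: supF.
have Re_le z : complex.Re z <= modulus z.
  case: z => u v /=; rewrite (le_trans (ler_norm u))// -sqrtr_sqr ler_wsqrtr// lerDl.
  exact: sqr_ge0.
have Im_le z : complex.Im z <= modulus z.
  case: z => u v /=; rewrite (le_trans (ler_norm v))// -sqrtr_sqr ler_wsqrtr// lerDr.
  exact: sqr_ge0.
have [|u ul] := coord (@complex.Re R).
  by move=> z w; have := Re_le (z - w); case: z w => z1 z2 [w1 w2].
have [|v vl] := coord (@complex.Im R).
  by move=> z w; have := Im_le (z - w); case: z w => z1 z2 [w1 w2].
exists (u +i* v)%C; apply/eqP; rewrite eq_le q_ge0 andbT.
suff : q (x - (u +i* v)%C%:A) <= 3 * mu by lra.
apply: le_inf_mull => // _ [z _ <-].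
have -> : x - (u +i* v)%C%:A = (x - z%:A) - ((u +i* v)%C - z)%:A.
  by rewrite scalerBl opprB addrA subrK.
rewrite (le_trans (mult_seminormB _ _))// mult_seminorm_alg.
have : modulus ((u +i* v)%C - z) <= `|u - complex.Re z| + `|v - complex.Im z|.
  case: z => z1 z2 /=.
  rewrite -(@ler_pXn2r _ 2) ?nnegrE ?sqrtr_ge0 ?addr_ge0//.
  rewrite sqr_sqrtr ?addr_ge0 ?sqr_ge0// [leRHS]sqrrD !real_normK ?num_real//.
  by rewrite [leRHS]addrAC lerDl mulrn_wge0// mulr_ge0.
have := ul z; have := vl z; lra.
Qed.

Lemma spectrum_unique x z w : q (x - z%:A) = 0 -> q (x - w%:A) = 0 -> z = w.
Proof.
move=> z0 w0; have := modulusB_le x z w; rewrite z0 w0 addr0 => H.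
apply/eqP; rewrite -subr_eq0; apply/negPn/negP => /modulus_gt0.
by rewrite ltNge H.
Qed.

(** The scalar [z] with [q (x - z) = 0] is unique, hence compatible with the
    operations of the algebra. *)
Lemma exists_character_of_seminorm : exists f : A -> R[i]^o,
  [/\ scalar f, (forall x y, f (x * y) = f x * f y), f 1 = 1
    & forall x, modulus (f x) = q x].
Proof.
pose f x := projT1 (cid (spectrum_nonempty x)).
have fP x : q (x - (f x)%:A) = 0 := projT2 (cid (spectrum_nonempty x)).
have small x z : q (x - z%:A) <= 0 -> f x = z.
  move=> H; apply: (@spectrum_unique x) => //.
  by apply/eqP; rewrite eq_le q_ge0 H.
exists f; split.
- move=> k x y; apply: small.
  have -> : k *: x + y - (k * f x + f y)%:A = k *: (x - (f x)%:A) + (y - (f y)%:A).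
    by rewrite scalerBr scalerA scalerDl opprD addrACA.
  by rewrite (le_trans (spectralD sq _ _))// mult_seminormZ !fP mulr0 addr0.
- move=> x y; apply: small.
  have -> : x * y - (f x * f y)%:A = (x - (f x)%:A) * y + f x *: (y - (f y)%:A).
    by rewrite mulrBl mulr_algl scalerBr scalerA addrA subrK.
  by rewrite (le_trans (spectralD sq _ _))// mult_seminormZ qM !fP mul0r mulr0 addr0.
- by apply: small; rewrite scale1r subrr -[X in q X](scale0r 1) mult_seminormZ modulus0 mul0r.
- move=> x; apply/eqP; rewrite eq_le; apply/andP; split.
    have := mult_seminormB x (x - (f x)%:A).
    by rewrite subKr mult_seminorm_alg fP addr0.
  have := spectralD sq (x - (f x)%:A) (f x)%:A.
  by rewrite subrK mult_seminorm_alg fP add0r.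
Qed.

End gelfand_mazur.

(** * Characters and the Gelfand map *)

Section gelfand_characters.
Context (R : realType) (p : R) (p_gt0 : 0 < p) (A : pBanachAlgType p).
Implicit Types (x : A) (f : A -> R[i]^o).
Local Open Scope classical_set_scope.

Lemma nbhs_pnorm x (P : set A) :
  nbhs x P <-> exists2 e : R, 0 < e & forall y, pnorm (x - y) < e -> P y.
Proof.
rewrite -nbhs_entourageE entourage_pnormE; split.
  move=> [U [e e0 eU] UP]; exists e => // y xy; apply: UP.
  by apply/xsectionP; apply: eU.
move=> [e e0 eP]; exists [set xy | pnorm (xy.1 - xy.2) < e]; first by exists e.
by move=> y /xsectionP; exact: eP.
Qed.

Lemma character_facts f : is_character f ->
  [/\ f 0 = 0, f 1 = 1, (forall x y, f (x + y) = f x + f y)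
    & forall (k : R[i]) x, f (k *: x) = k * f x].
Proof.
move=> [fl fM _ [a fa]].
have f0 : f 0 = 0.
  have := fl (-1) 0 0; rewrite scaler0 addr0 mulN1r => ->; exact: addNr.
have f1 : f 1 = 1 by apply: (mulfI fa); rewrite -fM !mulr1.
split=> // [x y|k x]; first by have := fl 1 x y; rewrite scale1r mul1r.
by have := fl k x 0; rewrite addr0 f0 addr0.
Qed.

(** If [|f x| > |x|^(1/p)], then [y = x / f x] has powers tending to [0], on
    which [f] is [1]. *)
Lemma character_le f x : is_character f -> modulus (f x) <= hnorm x.
Proof.
move=> fc; have [f0 f1 fD fZ] := character_facts fc.
have [_ fM fcont _] := fc.
rewrite leNgt; apply/negP => xf.
have fx0 : 0 < modulus (f x) by apply: le_lt_trans xf; exact: hnorm_ge0.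
have fxn : f x != 0 by apply/eqP => E; move: fx0; rewrite E modulus0 ltxx.
pose y := (f x)^-1 *: x.
have fy : f y = 1 by rewrite fZ mulVf.
have fyn n : f (y ^+ n) = 1.
  by elim: n => [|n IH]; rewrite ?expr0// exprS fM fy IH mulr1.
have y1 : pnorm y < 1.
  rewrite /y pnormZ modulusV -powR_inv1 ?(ltW fx0)// powRAC powR_inv1 ?powR_ge0//.
  rewrite mulrC ltr_pdivrMr ?powR_gt0// mul1r -(hnormK p_gt0).
  by rewrite gt0_ltr_powR ?nnegrE ?hnorm_ge0 ?(ltW fx0).
have := fcont 0; rewrite /continuous_at f0 => /cvgrPdist_lt/(_ 1 ltr01).
move=> /nbhs_pnorm[e e0 He].
suff [n yn] : exists n, pnorm (y ^+ n.+1) < e.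
  have := He (y ^+ n.+1); rewrite sub0r pnormN => /(_ yn).
  by rewrite fyn sub0r normrN normr1 ltxx.
have [y0|y0] := eqVneq y 0.
  by exists 0%N; rewrite expr1 y0 (pnorm0 p_gt0).
have ny0 := pnorm_gt0 y0.
apply: contrapT => /forallNP H.
suff : e <= 0 by rewrite leNgt e0.
apply: (@le_of_forall_geometric _ (pnorm y)^-1 _ (pnorm y)).
  by rewrite invf_gt1.
move=> n; have /negP := H n; rewrite -leNgt => /le_trans/(_ (pnormXS y n)).
rewrite exprVn mulrC ler_pdivrMr ?exprn_gt0// exprS.
done.
Qed.

Lemma character_of_bounded f : scalar f -> (forall x y, f (x * y) = f x * f y) ->
  f 1 = 1 -> (forall x, modulus (f x) <= hnorm x) -> is_character f.
Proof.
move=> fl fM f1 fb; split=> //; last by exists 1; rewrite f1 oner_neq0.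
move=> x; apply/cvgrPdist_lt => e e0.
have [e' e'0 eE] : exists2 e' : R, 0 < e' & e = e'%:C%C.
  case: e e0 => u v; rewrite ltcE/= => /andP[/eqP v0 u0]; exists u; [by []|].
  by rewrite v0.
apply/nbhs_pnorm; exists (e' `^ p); first by rewrite powR_gt0.
move=> y xy /=.
have -> : f x - f y = f (x - y).
  by rewrite [x - y]addrC -[- y]scaleN1r fl mulN1r addrC.
rewrite eE modulus_norm ltcR; apply: le_lt_trans (fb _) _.
rewrite -[ltRHS]powRr1 ?(ltW e'0)// -(mulfV (lt0r_neq0 p_gt0)) powRrM.
by rewrite gt0_ltr_powR ?invr_gt0 ?nnegrE ?pnorm_ge0 ?powR_ge0.
Qed.

Lemma support_seminorm_lbound x :
  lbound [set r | exists (n : nat) (s : 'I_n.+1 -> A),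
         x = \sum_(i < n.+1) s i /\ r = \sum_(i < n.+1) pnorm (s i) `^ p^-1] 0.
Proof. by move=> _ [n [s [_ ->]]]; apply: sumr_ge0 => i _; exact: powR_ge0. Qed.

Lemma support_seminorm_le x : support_seminorm x <= hnorm x.
Proof.
apply: ge_inf; first by exists 0; exact: support_seminorm_lbound.
by exists 0%N, (fun=> x); rewrite !big_ord_recl !big_ord0 !addr0.
Qed.

Lemma character_le_support f x : is_character f -> modulus (f x) <= support_seminorm x.
Proof.
move=> fc; have [f0 f1 fD fZ] := character_facts fc.
apply: lb_le_inf.
  by exists (hnorm x), 0%N, (fun=> x); rewrite !big_ord_recl !big_ord0 !addr0.
move=> _ [n [s [-> ->]]].
apply: (@le_trans _ _ (\sum_(i < n.+1) modulus (f (s i)))); last first.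
  by apply: ler_sum => i _; exact: character_le.
elim/big_ind2 : _ => [|u r v t ur vt|//]; first by rewrite f0 modulus0.
by rewrite fD (le_trans (modulusD _ _))// lerD.
Qed.

End gelfand_characters.

Section gelfand_transform.
Context (R : realType) (p : R) (p_gt0 : 0 < p) (A : pBanachAlgType p).
Context (m : R) (m_gt0 : 0 < m)
  (norm_sqr : forall a : A, pnorm a ^+ 2 <= m * pnorm (a ^+ 2)).
Local Open Scope classical_set_scope.

Lemma gelfand_linear : linear (@gelfand R p A).
Proof.
by move=> k x y; apply/continuousEP => f; have [fl _ _ _] := set_valP f; exact: fl.
Qed.

Lemma gelfand_monoid_morphism : monoid_morphism (@gelfand R p A).
Proof.
split=> [|x y]; apply/continuousEP => f; have fc := set_valP f.
  by have [_ f1 _ _] := character_facts fc; exact: f1.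
by have [_ fM _ _] := fc; exact: fM.
Qed.

(** The spectral radius of [a] is attained by a character; for [a = 0] the unit
    provides a character, so that the supremum is over a nonempty set. *)
Lemma exists_norming_character (a : A) : exists f : gelfand_space A,
  hnorm a <= m `^ p^-1 * modulus (gelfand_eval a f).
Proof.
have A_comm := commutative_of_norm_sqr p_gt0 m_gt0 norm_sqr.
pose rho := @spectral_radius R p A.
have srho : spectral_seminorm rho := spectral_radius_seminorm p_gt0 m_gt0 norm_sqr A_comm.
have norming b : 0 < rho b -> exists f : gelfand_space A, modulus (gelfand_eval b f) = rho b.
  move=> b0; have [q [sq qM qrho qb]] := exists_multiplicative A_comm srho b0.
  have [f [fl fM f1 fq]] := exists_character_of_seminorm sq qM.
  have fc : is_character f.
    apply: (character_of_bounded p_gt0 fl fM f1) => x.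
    by rewrite fq (le_trans (qrho x))// spectral_radius_le_hnorm.
  by exists (exist _ f (mem_set fc)); rewrite /gelfand_eval/= fq.
have le_rho := hnorm_le_spectral_radius p_gt0 m_gt0 norm_sqr.
have [->|a0] := eqVneq a 0.
  have [|f _] := norming 1; first exact: lt_le_trans ltr01 (spectral1_ge1 srho).
  exists f; rewrite /hnorm (pnorm0 p_gt0) powR0 ?invr_eq0 ?gt_eqF//.
  by rewrite mulr_ge0 ?powR_ge0 ?modulus_ge0.
have [|f fa] := norming a; last by exists f; rewrite fa; exact: le_rho.
have : 0 < hnorm a by rewrite powR_gt0 ?pnorm_gt0.
by move=> /lt_le_trans/(_ (le_rho a)); rewrite pmulr_rgt0 ?powR_gt0.
Qed.

Lemma gelfand_injective : injective (@gelfand R p A).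
Proof.
move=> a b ab; apply/eqP; rewrite -subr_eq0; apply/eqP; apply: pnorm0_eq0.
have [f] := exists_norming_character (a - b).
have fc := set_valP f; have [_ _ fD fZ] := character_facts fc.
have -> : gelfand_eval (a - b) f = 0.
  have : gelfand_eval a f = gelfand_eval b f by rewrite -[LHS]/(gelfand a f) ab.
  rewrite /gelfand_eval -scaleN1r fD fZ mulN1r => ->; exact: subrr.
rewrite modulus0 mulr0 => h0; rewrite -(hnormK p_gt0).
have -> : hnorm (a - b) = 0 by apply/eqP; rewrite eq_le h0 hnorm_ge0.
by rewrite powR0// gt_eqF.
Qed.

Lemma gelfand_le_support (a : A) : (sup_norm (gelfand a) <= (support_seminorm a)%:E)%E.
Proof.
apply: ge_ereal_sup => _ [f _ <-]; rewrite lee_fin.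
by apply: (character_le_support p_gt0); exact: set_valP.
Qed.

Lemma hnorm_le_gelfand (a : A) : ((m `^ (- p^-1) * hnorm a)%:E <= sup_norm (gelfand a))%E.
Proof.
have [f fa] := exists_norming_character a.
apply: (@le_trans _ _ (modulus (gelfand_eval a f))%:E); last first.
  by apply: ereal_sup_ubound; exists f.
by rewrite lee_fin powRN ler_pdivrMl ?powR_gt0.
Qed.

Lemma hnorm_le_support (a : A) : hnorm a <= m `^ p^-1 * support_seminorm a.
Proof.
have [f fa] := exists_norming_character a.
rewrite (le_trans fa)// ler_pM2l ?powR_gt0//.
by apply: (character_le_support p_gt0); exact: set_valP.
Qed.

End gelfand_transform.

Theorem theorem4p3 (R : realType) (p : R) (p_gt0 : 0 < p) (p_le1 : p <= 1)
    (A : pBanachAlgType p) (m : R) (m_gt0 : 0 < m)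
    (norm_sqr : forall a : A, pnorm a ^+ 2 <= m * pnorm (a ^+ 2)) :
  [/\ linear (@gelfand R p A),
      monoid_morphism (@gelfand R p A),
      injective (@gelfand R p A)
    & forall a : A,
      [/\ m `^ (- (2 / p)) * pnorm a `^ p^-1
            <= m `^ (- p^-1) * support_seminorm a,
          ((m `^ (- p^-1) * support_seminorm a)%:E
            <= sup_norm (gelfand a))%E,
          (sup_norm (gelfand a) <= (support_seminorm a)%:E)%E
        & support_seminorm a <= pnorm a `^ p^-1]].
Proof.
split; [exact: gelfand_linear|exact: gelfand_monoid_morphism|exact: gelfand_injective norm_sqr|].
move=> a; split.
- have -> : m `^ (- (2 / p)) = m `^ (- p^-1) * m `^ (- p^-1).
    rewrite -powRD ?(gt_eqF m_gt0) ?implybT//; congr (_ `^ _); ring.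
  rewrite -mulrA ler_pM2l ?powR_gt0// powRN ler_pdivrMl ?powR_gt0//.
  exact: hnorm_le_support norm_sqr a.
- apply: le_trans (hnorm_le_gelfand p_gt0 m_gt0 norm_sqr a).
  by rewrite lee_fin ler_pM2l ?powR_gt0// support_seminorm_le.
- exact: gelfand_le_support.
- exact: support_seminorm_le.
Qed.
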